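(* Let $0<l<1$. Let $L_0:L^2\to L^2$, $L_0f(x)=\int k_0(x,y)f(y)\,dy$, be an integral operator with stochastic kernel $k_0\in L^2([0,1]^2)$, and suppose $L_0$ satisfies (A1): $\lim_{n\to\infty}\|L_0^ng\|_2=0$ for every $g\in V$. Let $c\in\mathrm{span}\{f_0\}^\perp$. Suppose there is $\Xi'\subset\Xi(F_l)$ with $m(\Xi')>0$ such that for $y\in\Xi'$: $f_0(y)>0$, $\int_{F_l^y}((\mathrm{Id}-L_0^* )^{-1}c)^+(x)\,dx>0$ and $\int_{F_l^y}((\mathrm{Id}-L_0^* )^{-1}c)^-(x)\,dx>0$. Then the optimisation problem $$\min_{\dot k\in V_{\ker}\cap S_{k_0,l}}-\langle c,R(\dot k)\rangle_{L^2([0,1],\mathbb R)}\quad\text{subject to}\quad\|\dot k\|^2_{L^2([0,1]^2)}-1=0$$ has the unique solution $$\dot k(x,y)=\begin{cases}\dfrac{f_0(y)}{\alpha}\left(((\mathrm{Id}-L_0^* )^{-1}c)(x)-\dfrac{\int_{F_l^y}((\mathrm{Id}-L_0^* )^{-1}c)(z)\,dz}{m(F_l^y)}\right)&(x,y)\in F_l,\\[2mm]0&\text{otherwise},\end{cases}$$ where $\alpha>0$ is selected so that $\|\dot k\|_{L^2([0,1]^2)}=1$. Furthermore, if $c\in W:=\mathrm{span}\{f_0\}^\perp\cap L^\infty$, $k_0\in L^\infty([0,1]^2)$, and $k_0$ is such that $L_0:L^1\to L^1$ is compact, then $\dot k\in L^\infty([0,1]^2)$.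
   Context: $L^p=L^p([0,1],\mathbb R)$ with Lebesgue measure $m$; $V:=\{f\in L^2:\int f\,dm=0\}$; $V_{\ker}:=\{k\in L^2([0,1]^2):\int k(x,y)\,dx=0\text{ for a.e. }y\}$. A stochastic kernel is a nonnegative $k$ with $\int k(x,y)\,dx=1$ for a.e. $y$. $f_0\in L^2$ is the unique function with $L_0f_0=f_0$, $\int f_0\,dm=1$ (it exists under (A1)). $F_l:=\{(x,y)\in[0,1]^2:k_0(x,y)\ge l\}$; $F_l^y:=\{x\in[0,1]:(x,y)\in F_l\}$; $\Xi(F_l):=\{y\in[0,1]:m(F_l^y)>0\}$; $S_{k_0,l}:=\{k\in L^2([0,1]^2):\mathrm{supp}(k)\subseteq F_l\}$, where $\mathrm{supp}(k)\subseteq F_l$ means $k=0$ a.e. outside $F_l$. $R(\dot k):=(\mathrm{Id}-L_0)^{-1}\int\dot k(\cdot,y)f_0(y)\,dy$ for $\dot k\in V_{\ker}$, where $(\mathrm{Id}-L_0)^{-1}:V\to V$ is the bounded inverse of $\mathrm{Id}-L_0$ on $V$. $L_0^*$ is the $L^2$ adjoint of $L_0$, and $(\mathrm{Id}-L_0^* )^{-1}$ is the bounded inverse of $\mathrm{Id}-L_0^*$ on $\mathrm{span}\{f_0\}^\perp\subset L^2$. $h^+,h^-$ are the positive and negative parts of $h$. Equalities of kernels are a.e. *)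

(* Defs.v *)
From HB Require Import structures.
From mathcomp Require Import all_boot all_order all_algebra.
From mathcomp Require Import all_classical all_reals all_analysis.
Import Order.TTheory GRing.Theory Num.Theory.
Import numFieldNormedType.Exports.

Set Implicit Arguments.
Unset Strict Implicit.
Unset Printing Implicit Defensive.

Local Open Scope classical_set_scope.
Local Open Scope ring_scope.

(* Elements of L^p are represented by measurable functions with finite
   L^p-norm; equality of classes is almost everywhere equality. *)
Section Lp.
Context d (T : measurableType d) (R : realType).
Variable mu : {measure set T -> \bar R}.

Definition L1 : set (T -> R) := [set f | f \in Lfun mu 1%E].
Definition L2 : set (T -> R) := [set f | f \in Lfun mu 2%:E].
Definition Linfty : set (T -> R) := [set f | f \in Lfun mu +oo%E].

Definition L1norm (f : T -> R) : R := fine ('N[mu]_1%E [EFin \o f])%E.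
Definition L2norm (f : T -> R) : R := fine ('N[mu]_(2%:E) [EFin \o f])%E.

Definition inner (f g : T -> R) : R := \int[mu]_x (f x * g x).

Definition span1 (f : T -> R) : set (T -> R) :=
  [set g | exists a : R, g = (fun x => a * f x)].

Definition orth_compl (S : set (T -> R)) : set (T -> R) :=
  [set f | L2 f /\ forall g, S g -> inner f g = 0].

(* The L^2 adjoint; a bounded L has one, and it determines [adjoint L g] up to
   a null set. *)
Definition adjoint (L : (T -> R) -> (T -> R)) (g : T -> R) : T -> R :=
  xget (cst 0)
    [set h | L2 h /\ forall f, L2 f -> inner (L f) g = inner f h].

Definition id_minus (L : (T -> R) -> (T -> R)) (f : T -> R) : T -> R :=
  fun x => f x - L f x.

(* The inverse of A on the subspace S: a solution in S of A f = g. When A is a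
   bijection of S, this determines [inverse_on S A g] up to a null set; it is
   the junk value 0 when there is no solution. *)
Definition inverse_on (S : set (T -> R)) (A : (T -> R) -> (T -> R))
    (g : T -> R) : T -> R :=
  xget (cst 0) [set f | S f /\ A f = g %[ae mu]].

Definition L1_compact (L : (T -> R) -> (T -> R)) : Prop :=
  (forall f, L1 f -> L1 (L f)) /\
  forall f : nat -> T -> R,
    (forall n, L1 (f n)) -> (exists M : R, forall n, L1norm (f n) <= M) ->
    exists (phi : nat -> nat) (g : T -> R),
      [/\ {homo phi : i j / (i < j)%N}, L1 g &
          (fun n => L1norm (fun x => L (f (phi n)) x - g x)) @ \oo --> (0 : R)].

Definition unique_solution (J : (T -> R) -> R) (K : set (T -> R))
    (k : T -> R) : Prop :=
  [/\ K k, forall k', K k' -> J k <= J k' &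
      forall k', K k' -> (forall k'', K k'' -> J k' <= J k'') ->
        k' = k %[ae mu]].

End Lp.

Section UnitInterval.
Variable R : realType.

Definition itv01 : set R := `[0, 1].

Lemma lebesgue_measure_itv01_lty :
  (lebesgue_measure (itv01 : set (measurableTypeR R)) < +oo)%E.
Proof. by rewrite lebesgue_measure_itv/=; case: ifP => _; rewrite ?ltry. Qed.

(* [0, 1] with Lebesgue measure, as a measure on the real line that vanishes
   outside [0, 1]: values of functions outside [0, 1] are irrelevant. *)
Definition m01 : {finite_measure set (measurableTypeR R) -> \bar R} :=
  @mfrestr _ (measurableTypeR R) R itv01 lebesgue_measure (measurable_itv `[0, 1])
    lebesgue_measure_itv01_lty.

Definition m01x2 :
    {measure set (measurableTypeR R * measurableTypeR R) -> \bar R} :=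
  (m01 \x m01)%E.

Definition V : set (R -> R) := [set f | L2 m01 f /\ \int[m01]_x f x = 0].

Definition V_ker : set (R * R -> R) :=
  [set k | L2 m01x2 k /\ \forall y \ae m01, \int[m01]_x k (x, y) = 0].

Definition stochastic (k : R * R -> R) : Prop :=
  (\forall p \ae m01x2, 0 <= k p) /\
  (\forall y \ae m01, \int[m01]_x k (x, y) = 1).

Definition kernel_op (k : R * R -> R) (f : R -> R) : R -> R :=
  fun x => \int[m01]_y (k (x, y) * f y).

Definition A1 (L : (R -> R) -> (R -> R)) : Prop :=
  forall g, V g ->
    (fun n => ('N[m01]_(2%:E) [EFin \o iter n L g])%E) @ \oo --> 0%E.

Definition invariant_density (L : (R -> R) -> (R -> R)) (f0 : R -> R) : Prop :=
  [/\ L2 m01 f0, L f0 = f0 %[ae m01] & \int[m01]_x f0 x = 1].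

Definition level_set (k0 : R * R -> R) (l : R) : set (R * R) :=
  [set p | [/\ itv01 p.1, itv01 p.2 & l <= k0 p]].

(* The section {x | (x, y) \in F} is [ysection F y]. *)
Definition Xi (F : set (R * R)) : set R :=
  [set y | itv01 y /\ (0 < m01 (ysection F y))%E].

Definition supported_in (F : set (R * R)) : set (R * R -> R) :=
  [set k | L2 m01x2 k /\ \forall p \ae m01x2, ~ F p -> k p = 0].

(* The response R(k) = (Id - L0)^-1 (\int k(., y) f0(y) dy), the inverse being
   taken on V. *)
Definition response (L0 : (R -> R) -> (R -> R)) (f0 : R -> R)
    (k : R * R -> R) : R -> R :=
  inverse_on m01 V (id_minus L0) (kernel_op k f0).

(* (Id - L0^* )^-1, the inverse being taken on span{f0}^\perp. *)
Definition adjoint_resolvent (L0 : (R -> R) -> (R -> R)) (f0 : R -> R)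
    (c : R -> R) : R -> R :=
  inverse_on m01 (orth_compl m01 (span1 f0)) (id_minus (adjoint m01 L0)) c.

(* The function p = (x, y) |-> f0(y) / alpha * (h(x) - mean of h over F^y) on F,
   and 0 elsewhere. *)
Definition optimal_kernel (F : set (R * R)) (f0 h : R -> R) (alpha : R) :
    R * R -> R :=
  fun p => if p \in F then
    f0 p.2 / alpha *
      (h p.1 - (\int[m01]_(z in ysection F p.2) h z) /
               fine (m01 (ysection F p.2)))
  else 0.

End UnitInterval.

(* Main.v *)
(* Write q(x, y) = h(x) f0(y) with h = (Id - L0^* )^-1 c. By Fubini and the
   definition of the adjoint, <c, R(k)> = <k, q> for k in V_ker; for k supported
   in F with fibres of zero mean this is <k, P>, where P is q centred on each
   fibre F^y and cut off outside F. The optimum on the unit sphere is therefore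
   P / |P|, and the equality case of Cauchy-Schwarz gives uniqueness.

   The analytic point is that R(k) exists, i.e. that Id - L0 maps V onto V. For
   almost every y the function k0(., y) - f0 lies in V, so A1 sends it to 0
     under
   the iterates of L0;
     since L0 contracts the L^1 norm, dominated convergence in y
   yields |L0^n t|_1 <= e_n |t|_2 on V with e_n -> 0. Truncating k0 gives
   |L0 t|_2 <= e |t|_2 + M |t|_1. Together these bound Id - L0 from below on V.
   The sums s_n = g + L0 g + ... + L0^(n-1) g satisfy (Id - L0) s_n = g - L0^n
     g -> g,
   so they form a Cauchy sequence, whose limit solves (Id - L0) u = g. *)

Require Import Defs.
From HB Require Import structures.
From mathcomp Require Import all_boot all_order all_algebra.
From mathcomp Require Import all_classical all_reals all_analysis.
From mathcomp Require Import measurable_realfun ess_sup_inf ring lra.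
Import Order.TTheory GRing.Theory Num.Theory.
Import numFieldNormedType.Exports.

Set Implicit Arguments.
Unset Strict Implicit.
Unset Printing Implicit Defensive.

Local Open Scope classical_set_scope.
Local Open Scope ring_scope.

(** * Real-valued integrals and square-integrable functions *)

(** A1 gives convergence of each orbit separately and with no rate, and [L0] need not contract the
    L^2 norm, so neither absolute convergence of the Neumann series nor a bound on the inverse is
    immediate. Uniformity comes from the kernel: on functions t of zero mean, k0(x, y) may be
    replaced by k0(x, y) - f0(x), so every L0^(n+1) t is an average of iterates of one fixed family
    of fibres. The resulting smallness is only from L^2 to L^1, and the truncation estimate makes
    this enough: in t = (t - L0 t) + L0 t the last term costs a small multiple of |t|_2 plus M
    |t|_1, and telescoping gives |t|_1 <= n |t - L0 t|_1 + |L0^n t|_1, so all multiples of |t|_2 on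
    the right can be absorbed. Existence is settled differently for the two inverses. The response
    must be a true solution for every admissible kernel, which the argument above provides; for h,
    positivity of the integrals of h^+ already excludes the default value 0. Boundedness of the
    optimum comes from f0 = L0 f0 and from h being c plus the adjoint of L0 applied to h: a bounded
    kernel maps L^2 into L^infty. *)

Definition integrableR d (T : measurableType d) (R : realType)
  (mu : {measure set T -> \bar R}) (f : T -> R) :=
  mu.-integrable [set: T] (EFin \o f).

Section real_integrals.
Context d (T : measurableType d) (R : realType).
Variable mu : {measure set T -> \bar R}.
Implicit Types f g h : T -> R.
Local Notation intR := (integrableR mu).

Lemma integrableR_measurable f : intR f -> measurable_fun setT f.
Proof. by move=> /integrableP[/measurable_EFinP]. Qed.

Lemma integrableRD f g : intR f -> intR g -> intR (fun x => f x + g x).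
Proof. exact: integrableD. Qed.

Lemma integrableRZ a f : intR f -> intR (fun x => a * f x).
Proof. exact: integrableZl. Qed.

Lemma Rintegral_EFin f : intR f ->
  (\int[mu]_x f x)%:E = (\int[mu]_x (f x)%:E)%E.
Proof. by move=> If; rewrite /Rintegral fineK//; exact: integrable_fin_num. Qed.

Lemma ae_le_integrableR f g : measurable_fun setT f -> intR g ->
  {ae mu, forall x, `|f x| <= g x} -> intR f.
Proof.
move=> mf /integrableP[mg ig] fg; apply/integrableP; split.
  exact/measurable_EFinP.
apply: le_lt_trans ig; apply: ae_ge0_le_integral => //.
- by apply: measurableT_comp => //; exact/measurable_EFinP.
- exact: measurableT_comp.
- by apply: filterS fg => x /= fgx _; rewrite lee_fin (le_trans fgx)// ler_norm.
Qed.

Lemma ae_eq_Rintegral f g : measurable_fun setT f -> measurable_fun setT g ->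
  f = g %[ae mu] -> \int[mu]_x f x = \int[mu]_x g x.
Proof.
move=> mf mg fg; congr fine; apply: ae_eq_integral => //.
- exact/measurable_EFinP.
- exact/measurable_EFinP.
- by apply: filterS fg => x /= /[apply] ->.
Qed.

Lemma ae_ge0_Rintegral f : measurable_fun setT f ->
  {ae mu, forall x, 0 <= f x} -> 0 <= \int[mu]_x f x.
Proof.
move=> mf f0; rewrite (@ae_eq_Rintegral f (fun x => `|f x|)) ?Rintegral_ge0//.
  exact: measurableT_comp.
by apply: filterS f0 => x f0 _; rewrite ger0_norm.
Qed.

Lemma ae_le_Rintegral f g : intR f -> intR g ->
  {ae mu, forall x, f x <= g x} -> \int[mu]_x f x <= \int[mu]_x g x.
Proof.
move=> If Ig fg; rewrite -subr_ge0 -RintegralB//.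
apply: ae_ge0_Rintegral.
  by apply: measurable_funB; exact: integrableR_measurable.
by apply: filterS fg => x; rewrite subr_ge0.
Qed.

Lemma ae_eq0_Rintegral f : intR f -> {ae mu, forall x, 0 <= f x} ->
  \int[mu]_x f x = 0 -> f = cst 0 %[ae mu].
Proof.
move=> If f0 If0; have mf := integrableR_measurable If.
have : (\int[mu]_x `|(f x)%:E| = 0)%E.
  rewrite -[RHS]/(0%:E) -If0 Rintegral_EFin//; apply: ae_eq_integral => //.
  - by apply: measurableT_comp => //; exact/measurable_EFinP.
  - exact/measurable_EFinP.
  - by apply: filterS f0 => x f0 _ /=; rewrite ger0_norm.
move/ae_eq_integral_abs => /(_ measurableT) H.
have /H : measurable_fun [set: T] (EFin \o f) by exact/measurable_EFinP.
by apply: filterS => x /= /(_ I)[].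
Qed.

End real_integrals.

(** * Inner product and norm of L^2 *)

Section L2_space.
Context d (T : measurableType d) (R : realType).
Variable mu : {measure set T -> \bar R}.
Implicit Types f g h : T -> R.
Local Notation intR := (integrableR mu).
Local Notation "<| f , g |>" := (inner mu f g) (at level 0).
Local Notation N2 := (L2norm mu).

Lemma L2_measurable f : L2 mu f -> measurable_fun setT f.
Proof. by move=> /andP[]; rewrite inE. Qed.

Lemma L2P f : L2 mu f <-> measurable_fun setT f /\ intR (fun x => f x ^+ 2).
Proof.
split=> [f2|[mf /integrableP[_ if2]]].
  by split; [exact: L2_measurable|exact: Lfun2_integrable_sqr].
apply/andP; split; rewrite inE//= /finite_norm unlock poweR_lty//.
apply: le_lt_trans if2; rewrite le_eqVlt; apply/orP; left; apply/eqP.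
apply: eq_integral => x _ /=.
by rewrite powR_mulrn// normrX.
Qed.

Lemma L2_mul f g : L2 mu f -> L2 mu g -> intR (fun x => f x * g x).
Proof. by move=> f2 g2; apply/Lfun1_integrable; exact: Lfun2_mul_Lfun1. Qed.

Lemma L2_sqr f : L2 mu f -> intR (fun x => f x ^+ 2).
Proof. by move=> /L2P[]. Qed.

Lemma ae_le_L2 f g : measurable_fun setT f -> intR g ->
  {ae mu, forall x, f x ^+ 2 <= g x} -> L2 mu f.
Proof.
move=> mf Ig fg; apply/L2P; split => //; apply: ae_le_integrableR Ig _.
  exact: measurable_funX.
by apply: filterS fg => x; rewrite ger0_norm ?sqr_ge0.
Qed.

Lemma L2D f g : L2 mu f -> L2 mu g -> L2 mu (fun x => f x + g x).
Proof.
move=> f2 g2; have mf := L2_measurable f2; have mg := L2_measurable g2.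
apply: (@ae_le_L2 _ (fun x => 2 * (f x ^+ 2 + g x ^+ 2))).
- exact: measurable_funD.
- by apply/integrableRZ/integrableRD; exact: L2_sqr.
- by apply: aeW => x; have := sqr_ge0 (f x - g x); rewrite sqrrB sqrrD; lra.
Qed.

Lemma L2Z a f : L2 mu f -> L2 mu (fun x => a * f x).
Proof.
move=> f2; apply/L2P; split.
  by apply: measurable_funM => //; exact: L2_measurable.
under [X in integrableR _ X]eq_fun do rewrite exprMn.
exact/integrableRZ/L2_sqr.
Qed.

Lemma L2B f g : L2 mu f -> L2 mu g -> L2 mu (fun x => f x - g x).
Proof.
move=> f2 /(L2Z (-1)) g2; have := L2D f2 g2.
by under [X in L2 _ X -> _]eq_fun do rewrite mulN1r.
Qed.

Lemma L2_normr f : L2 mu f -> L2 mu (fun x => `|f x|).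
Proof.
move=> f2; apply/L2P; split.
  by apply: measurableT_comp => //; exact: L2_measurable.
under [X in integrableR _ X]eq_fun do rewrite real_normK ?num_real//.
exact: L2_sqr.
Qed.

Lemma innerC f g : <|f, g|> = <|g, f|>.
Proof. by apply: eq_Rintegral => x _; rewrite mulrC. Qed.

Lemma innerDl f g h : L2 mu f -> L2 mu g -> L2 mu h ->
  <|(fun x => f x + g x), h|> = <|f, h|> + <|g, h|>.
Proof.
move=> f2 g2 h2; rewrite /inner -RintegralD//; [|exact: L2_mul..].
by apply: eq_Rintegral => x _; rewrite mulrDl.
Qed.

Lemma innerBl f g h : L2 mu f -> L2 mu g -> L2 mu h ->
  <|(fun x => f x - g x), h|> = <|f, h|> - <|g, h|>.
Proof.
move=> f2 g2 h2; rewrite /inner -RintegralB//; [|exact: L2_mul..].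
by apply: eq_Rintegral => x _; rewrite mulrBl.
Qed.

Lemma innerZl a f g : L2 mu f -> L2 mu g ->
  <|(fun x => a * f x), g|> = a * <|f, g|>.
Proof.
move=> f2 g2; rewrite /inner -RintegralZl//; [|exact: L2_mul..].
by apply: eq_Rintegral => x _; rewrite mulrA.
Qed.

Lemma innerDr f g h : L2 mu f -> L2 mu g -> L2 mu h ->
  <|h, (fun x => f x + g x)|> = <|h, f|> + <|h, g|>.
Proof. by move=> *; rewrite innerC innerDl// innerC [in X in _ + X]innerC. Qed.

Lemma innerBr f g h : L2 mu f -> L2 mu g -> L2 mu h ->
  <|h, (fun x => f x - g x)|> = <|h, f|> - <|h, g|>.
Proof. by move=> *; rewrite innerC innerBl// innerC [in X in _ - X]innerC. Qed.

Lemma innerZr a f g : L2 mu f -> L2 mu g ->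
  <|g, (fun x => a * f x)|> = a * <|g, f|>.
Proof. by move=> *; rewrite innerC innerZl// innerC. Qed.

Lemma inner_ge0 f : 0 <= <|f, f|>.
Proof. by apply: Rintegral_ge0 => x _; rewrite -expr2 sqr_ge0. Qed.

Lemma ae_eq_inner f f' g g' : L2 mu f -> L2 mu f' -> L2 mu g -> L2 mu g' ->
  f = f' %[ae mu] -> g = g' %[ae mu] -> <|f, g|> = <|f', g'|>.
Proof.
move=> f2 f'2 g2 g'2 ff' gg'; apply: ae_eq_Rintegral.
- by apply: measurable_funM; exact: L2_measurable.
- by apply: measurable_funM; exact: L2_measurable.
- by apply: filterS2 ff' gg' => x /(_ I) -> /(_ I) ->.
Qed.

Lemma inner_eq0 f : L2 mu f -> <|f, f|> = 0 -> f = cst 0 %[ae mu].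
Proof.
move=> f2 /ae_eq0_Rintegral => /(_ (L2_mul f2 f2)).
have h : {ae mu, forall x, 0 <= f x * f x}.
  by apply: aeW => x; rewrite -expr2 sqr_ge0.
move=> /(_ h); apply: filterS => x /= /(_ I) /eqP.
by rewrite mulf_eq0 orbb => /eqP.
Qed.

(** No square integrability is required: if the integral of f^2 is infinite, [fine] sends both sides
    to 0. *)
Lemma L2normE f : N2 f = Num.sqrt <|f, f|>.
Proof.
rewrite /L2norm unlock /inner /Rintegral.
rewrite (_ : (fun x => _ `^ 2)%E = (fun x => (f x * f x)%:E)); last first.
  apply/funext => x /=; rewrite powR_mulrn//.
  by rewrite -normrX ger0_norm ?sqr_ge0// expr2.
have : (0 <= \int[mu]_x (f x * f x)%:E)%E.
  by apply: integral_ge0 => x _; rewrite lee_fin -expr2 sqr_ge0.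
case: (\int[mu]_x _)%E => [r r0||//] /=.
  by rewrite powR12_sqrt// -lee_fin.
by rewrite sqrtr0 /poweR ifF//; apply/negbTE; rewrite invr_eq0.
Qed.

Lemma L2norm_ge0 f : 0 <= N2 f.
Proof. by rewrite L2normE sqrtr_ge0. Qed.

Lemma sqr_L2norm f : N2 f ^+ 2 = <|f, f|>.
Proof. by rewrite L2normE sqr_sqrtr// inner_ge0. Qed.

(** Nonnegativity of |f - t g|^2, evaluated at its minimiser t = <f, g> / <g, g>. If g has norm 0 it
    vanishes almost everywhere, and so does the left-hand side. *)
Lemma sqr_inner_le f g : L2 mu f -> L2 mu g ->
  <|f, g|> ^+ 2 <= <|f, f|> * <|g, g|>.
Proof.
move=> f2 g2.
have H t : 0 <= <|f, f|> - 2 * t * <|f, g|> + t ^+ 2 * <|g, g|>.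
  have := inner_ge0 (fun x => f x - t * g x).
  have tg2 := L2Z t g2; have ftg2 := L2B f2 tg2.
  rewrite innerBl// !innerBr// !innerZl// !innerZr// (innerC g f) => H.
  by apply: le_trans H _; rewrite le_eqVlt; apply/orP; left; apply/eqP; ring.
have [g0|gN0] := eqVneq <|g, g|> 0; last first.
  have gp : 0 < <|g, g|> by rewrite lt_neqAle eq_sym gN0 inner_ge0.
  have := H (<|f, g|> / <|g, g|>).
  have -> : <|f, f|> - 2 * (<|f, g|> / <|g, g|>) * <|f, g|>
     + (<|f, g|> / <|g, g|>) ^+ 2 * <|g, g|>
     = (<|f, f|> * <|g, g|> - <|f, g|> ^+ 2) / <|g, g|> by field.
  by rewrite pmulr_lge0 ?invr_gt0// subr_ge0.
rewrite (@ae_eq_inner f f g (cst 0))//; last 3 first.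
- by have := L2Z 0 g2; under [X in L2 _ X -> _]eq_fun do rewrite mul0r.
- exact: ae_eq_refl.
- exact: inner_eq0.
rewrite /inner (@eq_Rintegral _ _ _ _ _ (cst 0)) ?Rintegral_cst//.
  by rewrite mul0r expr0n/= mulr_ge0// inner_ge0.
by move=> x _; rewrite mulr0.
Qed.

Lemma normr_inner_le f g : L2 mu f -> L2 mu g -> `|<|f, g|>| <= N2 f * N2 g.
Proof.
move=> f2 g2.
rewrite -(@ler_pXn2r _ 2)// ?nnegrE ?mulr_ge0 ?L2norm_ge0//.
by rewrite real_normK ?num_real// exprMn !sqr_L2norm sqr_inner_le.
Qed.

Lemma L2normD f g : L2 mu f -> L2 mu g ->
  N2 (fun x => f x + g x) <= N2 f + N2 g.
Proof.
move=> f2 g2; have fg2 := L2D f2 g2.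
rewrite -(@ler_pXn2r _ 2)// ?nnegrE ?addr_ge0 ?L2norm_ge0//.
rewrite sqrrD !sqr_L2norm innerDl// !innerDr// (innerC g f).
by have := normr_inner_le f2 g2; have := ler_norm <|f, g|>; lra.
Qed.

Lemma L2normZ a f : L2 mu f -> N2 (fun x => a * f x) = `|a| * N2 f.
Proof.
move=> f2; rewrite !L2normE innerZl ?innerZr//; last exact: L2Z.
by rewrite mulrA -expr2 sqrtrM ?sqr_ge0// sqrtr_sqr.
Qed.

Lemma L2normN f : N2 (fun x => - f x) = N2 f.
Proof.
rewrite !L2normE; congr Num.sqrt.
by apply: eq_Rintegral => x _; rewrite mulrNN.
Qed.

Lemma L2norm_sub_le f g : L2 mu f -> L2 mu g ->
  N2 (fun x => f x - g x) <= N2 f + N2 g.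
Proof.
move=> f2 g2; have := L2normD f2 (L2Z (-1) g2).
rewrite L2normZ// normrN1 mul1r.
by under [X in N2 X <= _ -> _]eq_fun do rewrite mulN1r.
Qed.

Lemma L2normBC f g : N2 (fun x => f x - g x) = N2 (fun x => g x - f x).
Proof. by rewrite -L2normN; congr L2norm; apply/funext => x; rewrite opprB. Qed.

Lemma L2normB_le f g h : L2 mu f -> L2 mu g -> L2 mu h ->
  N2 (fun x => f x - h x) <= N2 (fun x => f x - g x) + N2 (fun x => g x - h x).
Proof.
move=> f2 g2 h2; have := L2normD (L2B f2 g2) (L2B g2 h2).
by under [X in N2 X <= _ -> _]eq_fun do rewrite addrA subrK.
Qed.

Lemma ae_eq_L2norm f g : L2 mu f -> L2 mu g -> f = g %[ae mu] -> N2 f = N2 g.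
Proof. by move=> f2 g2 fg; rewrite !L2normE; congr Num.sqrt;
  exact: ae_eq_inner. Qed.

Lemma L2norm_eq0 f : L2 mu f -> N2 f = 0 -> f = cst 0 %[ae mu].
Proof. by move=> f2 f0; apply: inner_eq0 => //;
  rewrite -sqr_L2norm f0 expr0n. Qed.

Lemma L2norm_normr f : N2 (fun x => `|f x|) = N2 f.
Proof.
rewrite !L2normE; congr Num.sqrt; apply: eq_Rintegral => x _.
by rewrite -normrM ger0_norm// -expr2 sqr_ge0.
Qed.

Lemma Rintegral_normM_le f g : L2 mu f -> L2 mu g ->
  \int[mu]_x (`|f x| * `|g x|) <= N2 f * N2 g.
Proof.
move=> /L2_normr f2 /L2_normr g2; have := normr_inner_le f2 g2.
by rewrite !L2norm_normr; apply: le_trans; rewrite ler_norm.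
Qed.

End L2_space.

(** * Completeness of L^2 *)

Lemma EFin_cvg (R : realType) (u : nat -> R) (l : R) :
  u @ \oo --> l -> (fun n => (u n)%:E) @ \oo --> l%:E.
Proof. by move=> ul; apply: cvg_EFin => //; exact: nearW. Qed.

Section probability_L2.
Context d (T : measurableType d) (R : realType).
Variable mu : {finite_measure set T -> \bar R}.
Hypothesis mu1 : mu setT = 1%E.
Implicit Types f g h : T -> R.
Local Notation intR := (integrableR mu).
Local Notation N2 := (L2norm mu).

Lemma L2_cst a : L2 mu (cst a).
Proof. exact: Lfun_cst. Qed.

Lemma L2_integrable f : L2 mu f -> intR f.
Proof.
move=> f2; apply/Lfun1_integrable; apply: Lfun_subset12 => //.
by rewrite fin_num_measure.
Qed.

Lemma integrableR_norm f : intR f -> intR (fun x => `|f x|).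
Proof.
move=> If; apply: (@integrable_norm _ _ _ mu setT) => //.
Qed.

Lemma Rintegral_cst1 a : \int[mu]_x a = a.
Proof. by rewrite Rintegral_cst// [X in fine X]mu1 mulr1. Qed.

Lemma L2norm_cst a : N2 (cst a) = `|a|.
Proof.
rewrite L2normE (_ : inner _ _ _ = a ^+ 2) ?sqrtr_sqr//.
by rewrite expr2 -[RHS]Rintegral_cst1.
Qed.

Lemma L1_le_L2 f : L2 mu f -> \int[mu]_x `|f x| <= N2 f.
Proof.
move=> f2; have := Rintegral_normM_le f2 (L2_cst 1).
rewrite L2norm_cst /cst normr1 mulr1.
by under eq_Rintegral do rewrite mulr1.
Qed.

Lemma L2norm_dist_tail (f : nat -> T -> R) : (forall n, L2 mu (f n)) ->
  (forall n, N2 (fun x => f n.+1 x - f n x) <= 2^-1 ^+ n) ->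
  forall n m, N2 (fun x => f (n + m)%N x - f n x) <= 2 * 2^-1 ^+ n.
Proof.
move=> f2 fN n m.
(* The subtracted term makes the induction telescope, since 2 q^j - 2 q^(j+1) = q^j for q = 1/2. *)
suff H : N2 (fun x => f (n + m)%N x - f n x) <=
    2 * 2^-1 ^+ n - 2 * 2^-1 ^+ (n + m).
  apply: (le_trans H); rewrite gerBl mulr_ge0// exprn_ge0// invr_ge0//.
elim: m => [|m ih].
  rewrite addn0 subrr.
  under [X in N2 X]eq_fun do rewrite subrr.
  by rewrite -[X in N2 X]/(cst 0) L2norm_cst normr0.
rewrite addnS; apply: (le_trans (L2normB_le _ (f2 (n + m)%N) _)) => //.
have := fN (n + m)%N; rewrite exprS; lra.
Qed.

(** On a probability space the L^1 norms of the increments are also summable, so the sum of their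
    absolute values is integrable, hence finite almost everywhere: the telescoping series converges
    absolutely there. *)
Lemma ae_cvg_of_summable_L2norm (f : nat -> T -> R) : (forall n, L2 mu (f n)) ->
  (forall n, N2 (fun x => f n.+1 x - f n x) <= 2^-1 ^+ n) ->
  {ae mu, forall x, cvgn (f ^~ x)}.
Proof.
move=> f2 fN.
pose a n x : R := `|f n.+1 x - f n x|.
have a2 n : L2 mu (a n) by apply: L2_normr; exact: L2B.
have ma n : measurable_fun setT (EFin \o a n).
  by apply/measurable_EFinP; exact: L2_measurable.
have aN n : (\int[mu]_x (a n x)%:E <= (2^-1 ^+ n)%:E)%E.
  rewrite -Rintegral_EFin ?lee_fin; last exact: L2_integrable.
  by apply: le_trans (fN n); apply: L1_le_L2; exact: L2B.
have Sa : (\int[mu]_x (\sum_(n <oo) (a n x)%:E) < +oo)%E.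
  rewrite integral_nneseries//; last by move=> n x _; rewrite lee_fin /a.
  apply: (@le_lt_trans _ _ (\sum_(n <oo) (2^-1 ^+ n)%:E)%E).
    apply: lee_nneseries => n _; last exact: aN.
    by move=> _; apply: integral_ge0 => x _; rewrite lee_fin /a.
  have := @cvg_geometric_series R 1 2^-1.
  rewrite ger0_norm ?invr_ge0// invf_lt1// ltr1n => /(_ isT) H.
  suff -> : (\sum_(n <oo) (2^-1 ^+ n)%:E = (1 * (1 - 2^-1)^-1)%:E :> \bar R)%E.
    exact: ltry.
  apply/cvg_lim => //; apply: cvg_trans (EFin_cvg H).
  apply: near_eq_cvg; near=> n; rewrite /series/= /geometric sumEFin;
    congr EFin.
  by apply: eq_bigr => i _; rewrite /= mul1r.
have ISa : mu.-integrable setT (fun x => \sum_(n <oo) (a n x)%:E)%E.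
  apply/integrableP; split.
    apply: ge0_emeasurable_sum => //.
    - by move=> n x _ _; rewrite lee_fin /a.
    - by move=> n _; exact: ma.
  rewrite (_ : integral _ _ _ = \int[mu]_x (\sum_(n <oo) (a n x)%:E))%E//.
  apply: eq_integral => x _; rewrite gee0_abs// nneseries_ge0// => n _ _.
  by rewrite lee_fin /a.
have := integrable_ae measurableT ISa; apply: filterS => x /(_ I) Hx.
have ub n : \sum_(0 <= i < n) a i x <= fine (\sum_(n <oo) (a n x)%:E)%E.
  rewrite -lee_fin fineK// -sumEFin; apply: nneseries_lim_ge => i _ _.
  by rewrite lee_fin /a.
have c : cvgn (series (fun n => f n.+1 x - f n x)).
  apply: normed_cvg.
  apply: nondecreasing_is_cvgn.
    by apply/nondecreasing_seqP => n; rewrite -subr_ge0 seriesSB;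
      exact: normr_ge0.
  by exists (fine (\sum_(n <oo) (a n x)%:E)%E) => _ [n _ <-]; exact: ub.
rewrite (_ : f ^~ x = cst (f 0%N x) \+ series (fun n => f n.+1 x - f n x)).
  by apply: is_cvgD => //; exact: is_cvg_cst.
apply/funext => n /=.
exact: (eq_sum_telescope (f ^~ x) n).
Unshelve. all: by end_near. Qed.

(** The limit is defined as a pointwise limsup, which is measurable everywhere and equals the limit
    almost everywhere. Fatou's lemma then transfers the tail bound [L2norm_dist_tail], and with it
    square integrability. *)
Lemma L2_complete (f : nat -> T -> R) : (forall n, L2 mu (f n)) ->
  (forall n, N2 (fun x => f n.+1 x - f n x) <= 2^-1 ^+ n) ->
  exists2 g, L2 mu g & forall n, N2 (fun x => f n x - g x) <= 2 * 2^-1 ^+ n.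
Proof.
move=> f2 fN.
pose g x := fine (limn_esup (fun n => (f n x)%:E)).
have mg : measurable_fun setT g.
  apply: (measurableT_comp (fine_measurable measurableT)).
  by apply: measurable_fun_limn_esup => n; apply/measurable_EFinP;
    exact: L2_measurable.
have fg : {ae mu, forall x, f ^~ x @ \oo --> g x}.
  have := ae_cvg_of_summable_L2norm f2 fN; apply: filterS => x /cvg_ex[l fl].
  have [_ gE] := cvg_limn_einf_sup (EFin_cvg fl).
  by rewrite /g gE.
have gf n : mu.-integrable setT (EFin \o (fun x => (g x - f n x) ^+ 2)) /\
    (\int[mu]_x ((g x - f n x) ^+ 2)%:E <= ((2 * 2^-1 ^+ n) ^+ 2)%:E)%E.
  have mgf : measurable_fun setT (EFin \o (fun x => (g x - f n x) ^+ 2)).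
    apply/measurable_EFinP; apply: measurable_funX;
      apply: measurable_funB => //.
    exact: L2_measurable.
  have H : (\int[mu]_x ((g x - f n x) ^+ 2)%:E <= ((2 * 2^-1 ^+ n) ^+ 2)%:E)%E.
    have mfm m : measurable_fun setT (fun x => ((f (n + m)%N x - f n x) ^+
      2)%:E).
      apply/measurable_EFinP; apply: measurable_funX;
        apply: measurable_funB => //; exact: L2_measurable.
    have f0 m x : setT x -> (0 <= ((f (n + m)%N x - f n x) ^+ 2)%:E)%E.
      by move=> _; rewrite lee_fin sqr_ge0.
    (* Fatou along m, with n fixed: the integrands converge to (g - f n)^2, and each of their
       integrals obeys the tail bound. *)
    have := fatou mu measurableT mfm f0.
    rewrite (_ : (\int[mu]_x limn_einf _)%E = (\int[mu]_x ((g x - f n x) ^+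
      2)%:E)%E); last first.
      apply: ae_eq_integral => //.
        apply: measurableT_comp => //; apply: measurable_fun_limn_esup => m.
        by apply: measurableT_comp => //; exact: mfm.
      apply: filterS fg => x fgx _.
      have H : (fun m => ((f (n + m)%N x - f n x) ^+ 2)%:E) @ \oo --> ((g x - f
        n x) ^+ 2)%:E.
        apply: EFin_cvg.
        apply: (@cvg_comp _ _ _ (fun m => f (n + m)%N x - f n x) (fun t : R =>
          t ^+ 2) _ (nbhs (g x - f n x))); last exact: exprn_continuous.
        apply: cvgB; last exact: cvg_cst.
        under [X in X @ _ --> _]eq_fun do rewrite addnC.
        by apply: (@cvg_comp _ _ _ (addn^~ n) (f ^~ x) _ _ _ (cvg_addnr n) fgx).
      by have [] := cvg_limn_einf_sup H.
    move=> /le_trans; apply; apply: le_trans (limn_einf_sup _) _.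
    rewrite limn_esup_lim; apply: lime_le; first exact: is_cvg_esups.
    apply: nearW => k; apply: ge_ereal_sup => _ [m _ <-].
    under eq_integral do rewrite expr2.
    have fm2 := L2B (f2 (n + m)%N) (f2 n).
    rewrite -(Rintegral_EFin (L2_mul fm2 fm2)) lee_fin -[leLHS]/(inner _ _ _)
      -sqr_L2norm.
    by rewrite ler_pXn2r ?nnegrE ?mulr_ge0 ?L2norm_ge0 ?exprn_ge0 ?invr_ge0//
      L2norm_dist_tail.
  split=> //; apply/integrableP; split => //.
  under eq_integral => x _ do rewrite /= ger0_norm ?sqr_ge0//.
  by apply: le_lt_trans H _; rewrite ltry.
exists g => [|n].
  have -> : g = (fun x => (g x - f 0%N x) + f 0%N x).
    by apply/funext => x; rewrite subrK.
  apply: L2D => //; apply/L2P; split; last by case: (gf 0%N).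
  by apply: measurable_funB => //; exact: L2_measurable.
rewrite L2normBC L2normE -[leRHS]ger0_norm -?sqrtr_sqr; last first.
  by rewrite mulr_ge0// exprn_ge0// invr_ge0.
apply: ler_wsqrtr; rewrite -lee_fin /inner Rintegral_EFin; last exact: (gf n).1.
exact: (gf n).2.
Qed.

End probability_L2.

(** * Fubini's theorem for real-valued integrals *)

Section real_Fubini.
Context d1 d2 (T1 : measurableType d1) (T2 : measurableType d2) (R : realType).
Variable m1 : {sigma_finite_measure set T1 -> \bar R}.
Variable m2 : {sigma_finite_measure set T2 -> \bar R}.
Implicit Types k : T1 * T2 -> R.
Local Notation pi := (m1 \x m2)%E.

Lemma measurable_section1 k x : measurable_fun setT k ->
  measurable_fun setT (fun y => k (x, y)).
Proof. by move=> mk; exact: measurableT_comp. Qed.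

Lemma measurable_section2 k y : measurable_fun setT k ->
  measurable_fun setT (fun x => k (x, y)).
Proof. by move=> mk; exact: measurableT_comp. Qed.

(** Tonelli applies to the positive and negative parts separately, so [k] need only be measurable;
    [fine] then preserves measurability even where an inner integral is infinite. *)
Lemma measurable_Rintegral1 k : measurable_fun setT k ->
  measurable_fun setT (fun x => \int[m2]_y k (x, y)).
Proof.
move=> mk; apply: (measurableT_comp (fine_measurable measurableT)).
have mk' : measurable_fun setT (EFin \o k) by exact/measurable_EFinP.
rewrite (_ : (fun x => integral _ _ _) = (fun x =>
  \int[m2]_y (EFin \o k)^\+%E (x, y) - \int[m2]_y (EFin \o k)^\-%E (x, y))%E).
  apply: emeasurable_funB.
    by apply: (measurable_fun_fubini_tonelli_F (EFin \o k)^\+%E) => //;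
      exact: measurable_funepos.
  by apply: (measurable_fun_fubini_tonelli_F (EFin \o k)^\-%E) => //;
    exact: measurable_funeneg.
apply/funext => x; rewrite [LHS]integralE.
by congr (_ - _)%E; apply: eq_integral => z _; rewrite ?funeposE ?funenegE.
Qed.

Lemma measurable_Rintegral2 k : measurable_fun setT k ->
  measurable_fun setT (fun y => \int[m1]_x k (x, y)).
Proof.
move=> mk; apply: (measurableT_comp (fine_measurable measurableT)).
have mk' : measurable_fun setT (EFin \o k) by exact/measurable_EFinP.
rewrite (_ : (fun x => integral _ _ _) = (fun y =>
  \int[m1]_x (EFin \o k)^\+%E (x, y) - \int[m1]_x (EFin \o k)^\-%E (x, y))%E).
  apply: emeasurable_funB.
    by apply: (measurable_fun_fubini_tonelli_G (EFin \o k)^\+%E) => //;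
      exact: measurable_funepos.
  by apply: (measurable_fun_fubini_tonelli_G (EFin \o k)^\-%E) => //;
    exact: measurable_funeneg.
apply/funext => x; rewrite [LHS]integralE.
by congr (_ - _)%E; apply: eq_integral => z _; rewrite ?funeposE ?funenegE.
Qed.

(** An integrable function is finite almost everywhere, so [fine] alters it on a null set only. This
    carries Fubini from extended-real integrals to [Rintegral], whose inner integrals have already
    passed through [fine]. *)
Lemma integrableR_fine d (T : measurableType d) (mu : {measure set T -> \bar R})
    (F : T -> \bar R) : mu.-integrable setT F ->
  integrableR mu (fine \o F) /\ \int[mu]_x fine (F x) = fine (\int[mu]_x F x)%E.
Proof.
move=> IF; have mF := measurable_int _ IF.
have mf : measurable_fun setT (EFin \o (fine \o F)).
  by apply/measurable_EFinP;
    exact: (measurableT_comp (fine_measurable measurableT)).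
split.
  apply: le_integrable IF => // x _ /=.
  by case: (F x) => //=; rewrite ?normr0 ?leey.
congr fine; apply: ae_eq_integral => //.
have := integrable_ae measurableT IF; apply: filterS => x /(_ I) Fx _ /=.
by rewrite fineK.
Qed.

Lemma integrableR_section1 k : integrableR pi k ->
  {ae m1, forall x, integrableR m2 (fun y => k (x, y))}.
Proof. exact: ae_integrable1. Qed.

Lemma integrableR_section2 k : integrableR pi k ->
  {ae m2, forall y, integrableR m1 (fun x => k (x, y))}.
Proof. exact: ae_integrable2. Qed.

Lemma integrableR_Rintegral1 k : integrableR pi k ->
  integrableR m1 (fun x => \int[m2]_y k (x, y)).
Proof. by move=> Ik; have [] := integrableR_fine (integrable_fubini_F Ik). Qed.

Lemma integrable_fubini2 (k : T1 * T2 -> \bar R) : pi.-integrable setT k ->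
  m2.-integrable setT (fun y => \int[m1]_x k (x, y))%E.
Proof.
move=> Ik; have mk := measurable_int _ Ik.
apply/integrableP; split; first exact: (measurable_fubini_G Ik).
apply: le_lt_trans ((integrable21ltyP m1 m2 mk).1 Ik).
apply: ge0_le_integral => //.
- by apply: measurableT_comp => //; exact: (measurable_fubini_G Ik).
- apply: (measurable_fun_fubini_tonelli_G (abse \o k)).
    exact: measurableT_comp.
  by move=> p; exact: abse_ge0.
- by move=> y _; apply: le_abse_integral => //; exact: measurableT_comp.
Qed.

Lemma integrableR_Rintegral2 k : integrableR pi k ->
  integrableR m2 (fun y => \int[m1]_x k (x, y)).
Proof. by move=> Ik; have [] := integrableR_fine (integrable_fubini2 Ik). Qed.

Lemma Rintegral_Fubini1 k : integrableR pi k ->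
  \int[pi]_p k p = \int[m1]_x \int[m2]_y k (x, y).
Proof.
move=> Ik; have [_ E] := integrableR_fine (integrable_fubini_F Ik).
by rewrite [RHS]E /Rintegral; congr fine;
  rewrite -[RHS]/(integral _ _ _) integral12_prod_meas1.
Qed.

Lemma Rintegral_Fubini2 k : integrableR pi k ->
  \int[pi]_p k p = \int[m2]_y \int[m1]_x k (x, y).
Proof.
move=> Ik; have [_ E] := integrableR_fine (integrable_fubini2 Ik).
by rewrite [RHS]E /Rintegral; congr fine;
  rewrite -[RHS]/(integral _ _ _) integral21_prod_meas1.
Qed.

Lemma integrableR_tensor (f : T1 -> R) (g : T2 -> R) :
  integrableR m1 f -> integrableR m2 g ->
  integrableR pi (fun p => f p.1 * g p.2).
Proof.
move=> If Ig; have mf := integrableR_measurable If.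
have mg := integrableR_measurable Ig.
apply/integrable12ltyP.
  apply/measurable_EFinP; apply: measurable_funM; exact: measurableT_comp.
have /integrableP[_ If'] := If; have /integrableP[_ Ig'] := Ig.
rewrite (_ : integral _ _ _ = \int[m1]_x (`|(f x)%:E| * \int[m2]_y `|(g
  y)%:E|))%E; last first.
  apply: eq_integral => x _; rewrite -ge0_integralZl//.
  - by apply: eq_integral => y _ /=; rewrite normrM EFinM.
  - by apply: measurableT_comp => //; exact/measurable_EFinP.
rewrite ge0_integralZr//; last 2 first.
- by apply: measurableT_comp => //; exact/measurable_EFinP.
- exact: integral_ge0.
rewrite lte_mul_pinfty//; first exact: integral_ge0.
by rewrite ge0_fin_numE//; exact: integral_ge0.
Qed.

Lemma ae_fst (P : T1 -> Prop) : {ae m1, forall x, P x} -> {ae pi, forall p, P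
  p.1}.
Proof.
move=> [N [mN N0 PN]]; exists (N `*` setT); split.
- exact: measurableX.
- by rewrite [LHS]product_measure1E// [X in (X * _)%E]N0 mul0e.
- by move=> p Pp; split => //; apply: PN.
Qed.

Lemma ae_snd (P : T2 -> Prop) : {ae m2, forall y, P y} -> {ae pi, forall p, P
  p.2}.
Proof.
move=> [N [mN N0 PN]]; exists (setT `*` N); split.
- exact: measurableX.
- by rewrite [LHS]product_measure1E// [X in (_ * X)%E]N0 mule0.
- by move=> p Pp; split => //; apply: PN.
Qed.

(** The measures of the sections of a null set form a nonnegative function of x whose integral is
    the product measure of that set, namely 0. *)
Lemma ae_section1 (P : T1 * T2 -> Prop) : {ae pi, forall p, P p} ->
  {ae m1, forall x, {ae m2, forall y, P (x, y)}}.
Proof.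
move=> [N [mN N0 PN]].
have : (\int[m1]_x `|m2 (xsection N x)| = 0)%E.
  by under eq_integral do rewrite gee0_abs//.
move/ae_eq_integral_abs => /(_ measurableT) H.
have /H : measurable_fun setT (fun x => m2 (xsection N x)) by exact:
  measurable_fun_xsection.
apply: filterS => x /(_ I) /= Nx; exists (xsection N x); split => //.
  exact: measurable_xsection.
by move=> y Py; rewrite /xsection/= inE; apply: PN.
Qed.

Lemma ae_section2 (P : T1 * T2 -> Prop) : {ae pi, forall p, P p} ->
  {ae m2, forall y, {ae m1, forall x, P (x, y)}}.
Proof.
move=> [N [mN N0 PN]].
have mG := indic_measurable_fun_fubini_tonelli_G m1 mN.
have : (\int[m2]_y `|m1 (ysection N y)| = 0)%E.
  under eq_integral do rewrite gee0_abs//.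
  (* The product measure is defined by integrating the sections over the first variable. Tonelli for
     the indicator of [N] gives the same value through the other sections. *)
  have := @fubini_tonelli2 _ _ _ _ _ m1 m2 (EFin \o \1_N).
  rewrite integral_indic// setIT.
  have m1N : measurable_fun setT (EFin \o (\1_N : _ -> R)).
    by apply/measurable_EFinP; exact: measurable_indic.
  move=> /(_ m1N) H; rewrite [RHS](_ : 0%E = pi N)// H; last first.
    by move=> p; rewrite lee_fin.
  by apply: eq_integral => y _; rewrite (indic_fubini_tonelli_GE m1 mN).
move/ae_eq_integral_abs => /(_ measurableT) H.
have /H : measurable_fun setT (fun y => m1 (ysection N y)) by exact:
  measurable_fun_ysection.
apply: filterS => y /(_ I) /= Ny; exists (ysection N y); split => //.
  exact: measurable_ysection.
by move=> x Px; rewrite /ysection/= inE; apply: PN.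
Qed.

End real_Fubini.

(** * Integral operators with square-integrable kernels *)

Section integral_operators.
Context d (T : measurableType d) (R : realType).
Variable mu : {finite_measure set T -> \bar R}.
Implicit Types (f g : T -> R) (k : T * T -> R).
Local Notation N2 := (L2norm mu).
Local Notation pi := (mu \x mu)%E.
Local Notation NN := (L2norm (mu \x mu)%E).

(** For [mu] equal to [m01] this is convertible with [kernel_op], so the results below apply to it
    directly. *)
Definition integral_op k f : T -> R := fun x => \int[mu]_y (k (x, y) * f y).

Definition kernel_tr k : T * T -> R := fun p => k (p.2, p.1).

Definition kernel_comp k k' : T * T -> R :=
  fun p => \int[mu]_z (k (p.1, z) * k' (z, p.2)).

Lemma L2_tensor f g : L2 mu f -> L2 mu g -> L2 pi (fun p => f p.1 * g p.2).
Proof.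
move=> f2 g2; apply/L2P; split.
  by apply: measurable_funM; apply: measurableT_comp => //;
    [exact: L2_measurable f2|exact: L2_measurable g2].
under [X in integrableR _ X]eq_fun do rewrite exprMn.
by apply: (@integrableR_tensor _ _ _ _ _ mu mu (fun x => f x ^+ 2) (fun y => g
  y ^+ 2)); exact: L2_sqr.
Qed.

Lemma L2_section1 k : L2 pi k -> {ae mu, forall x, L2 mu (fun y => k (x, y))}.
Proof.
move=> k2; have mk := L2_measurable k2.
have := integrableR_section1 (L2_sqr k2); apply: filterS => x kx.
by apply/L2P; split => //; exact: measurable_section1.
Qed.

Lemma L2_section2 k : L2 pi k -> {ae mu, forall y, L2 mu (fun x => k (x, y))}.
Proof.
move=> k2; have mk := L2_measurable k2.
have := integrableR_section2 (L2_sqr k2); apply: filterS => x kx.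
by apply/L2P; split => //; exact: measurable_section2.
Qed.

Lemma measurable_kernel_tr k : measurable_fun setT k ->
  measurable_fun setT (kernel_tr k).
Proof.
move=> mk; apply: (measurableT_comp mk).
by apply/measurable_fun_pairP; split;
  [exact: measurable_snd|exact: measurable_fst].
Qed.

Lemma L2_kernel_tr k : L2 pi k -> L2 pi (kernel_tr k).
Proof.
move=> k2; have mk := L2_measurable k2; have mk' := measurable_kernel_tr mk.
apply/L2P; split => //; apply/integrable12ltyP.
  by apply/measurable_EFinP; exact: measurable_funX.
have Ik := L2_sqr k2.
by apply: (integrable21ltyP mu mu (measurable_int _ Ik)).1.
Qed.

Lemma measurable_integral_op k f : measurable_fun setT k ->
  measurable_fun setT f -> measurable_fun setT (integral_op k f).
Proof.
move=> mk mf; apply: (@measurable_Rintegral1 _ _ _ _ _ mu (fun p => k p * f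
  p.2)).
by apply: measurable_funM => //; exact: measurableT_comp.
Qed.

(** Cauchy-Schwarz on almost every section; integrating in x yields the Hilbert-Schmidt bound
    [L2norm_integral_op_le]. *)
Lemma sqr_integral_op_le k f : L2 pi k -> L2 mu f ->
  {ae mu, forall x, integral_op k f x ^+ 2 <= \int[mu]_y (k (x, y) ^+ 2) * N2 f
    ^+ 2}.
Proof.
move=> k2 f2; have := L2_section1 k2; apply: filterS => x kx.
have := sqr_inner_le kx f2; rewrite sqr_L2norm /inner.
by under [in X in _ <= X * _]eq_Rintegral do rewrite -expr2.
Qed.

Lemma L2_integral_op k f : L2 pi k -> L2 mu f -> L2 mu (integral_op k f).
Proof.
move=> k2 f2; apply: (ae_le_L2 _ _ (sqr_integral_op_le k2 f2)).
  exact: measurable_integral_op (L2_measurable k2) (L2_measurable f2).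
under [X in integrableR _ X]eq_fun do rewrite mulrC.
exact/integrableRZ/(integrableR_Rintegral1 (L2_sqr k2)).
Qed.

Lemma L2norm_integral_op_le k f : L2 pi k -> L2 mu f ->
  N2 (integral_op k f) <= NN k * N2 f.
Proof.
move=> k2 f2; have kf2 := L2_integral_op k2 f2.
rewrite -(@ler_pXn2r _ 2)// ?nnegrE ?mulr_ge0 ?L2norm_ge0//.
have Ik := integrableR_Rintegral1 (L2_sqr k2).
rewrite exprMn sqr_L2norm (sqr_L2norm _ k).
have -> : inner pi k k * N2 f ^+ 2 = \int[mu]_x (\int[mu]_y (k (x, y) ^+ 2) *
  N2 f ^+ 2).
  rewrite RintegralZr//; congr (_ * _).
  rewrite -(Rintegral_Fubini1 (L2_sqr k2)).
  by apply: eq_Rintegral => p _; rewrite expr2.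
apply: ae_le_Rintegral; first exact: L2_mul.
  under [X in integrableR _ X]eq_fun do rewrite mulrC.
  exact: integrableRZ.
have := sqr_integral_op_le k2 f2; apply: filterS => x.
by rewrite -expr2.
Qed.

Lemma inner_integral_op k f g : L2 pi k -> L2 mu f -> L2 mu g ->
  inner mu g (integral_op k f) = inner pi k (fun p => g p.1 * f p.2).
Proof.
move=> k2 f2 g2; have t2 := L2_tensor g2 f2; have I := L2_mul k2 t2.
rewrite [RHS]/inner (Rintegral_Fubini1 I); apply: ae_eq_Rintegral.
- by have := L2_mul g2 (L2_integral_op k2 f2); exact: integrableR_measurable.
- exact/integrableR_measurable/(integrableR_Rintegral1 I).
have := L2_section1 k2; apply: filterS => x kx _ /=.
rewrite -RintegralZl//; last exact: L2_mul.
by apply: eq_Rintegral => y _; rewrite mulrCA.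
Qed.

(** The right-hand side is the double integral of [inner_integral_op], here evaluated in the other
    order. Comparing the two shows that the transposed kernel gives the adjoint. *)
Lemma inner_integral_op_tr k f g : L2 pi k -> L2 mu f -> L2 mu g ->
  inner mu f (integral_op (kernel_tr k) g) = inner pi k (fun p => g p.1 * f
    p.2).
Proof.
move=> k2 f2 g2; have t2 := L2_tensor g2 f2; have I := L2_mul k2 t2.
rewrite [RHS]/inner (Rintegral_Fubini2 I); apply: ae_eq_Rintegral.
- have := L2_mul f2 (L2_integral_op (L2_kernel_tr k2) g2).
  exact: integrableR_measurable.
- exact/integrableR_measurable/(integrableR_Rintegral2 I).
have := L2_section2 k2; apply: filterS => x kx _ /=.
rewrite -RintegralZl//; last exact: L2_mul.
by apply: eq_Rintegral => y _; rewrite /kernel_tr/=; ring.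
Qed.

Lemma integral_op_adjoint k f g : L2 pi k -> L2 mu f -> L2 mu g ->
  inner mu (integral_op k f) g = inner mu f (integral_op (kernel_tr k) g).
Proof.
by move=> k2 f2 g2; rewrite innerC inner_integral_op// inner_integral_op_tr.
Qed.

(** The equality holds at every x, because each integral over y ignores a null set. It can therefore
    be used for rewriting under a further operator. *)
Lemma ae_eq_integral_op k f g : measurable_fun setT k ->
  measurable_fun setT f -> measurable_fun setT g -> f = g %[ae mu] ->
  integral_op k f = integral_op k g.
Proof.
move=> mk mf mg fg; apply/funext => x; apply: ae_eq_Rintegral.
- by apply: measurable_funM => //; exact: measurable_section1.
- by apply: measurable_funM => //; exact: measurable_section1.
- by apply: filterS fg => y /= /[apply] ->.
Qed.

Lemma integral_opD k f g : L2 pi k -> L2 mu f -> L2 mu g ->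
  integral_op k (fun x => f x + g x) =
  (fun x => integral_op k f x + integral_op k g x) %[ae mu].
Proof.
move=> k2 f2 g2; have := L2_section1 k2; apply: filterS => x kx _.
exact: innerDr.
Qed.

Lemma integral_opB k f g : L2 pi k -> L2 mu f -> L2 mu g ->
  integral_op k (fun x => f x - g x) =
  (fun x => integral_op k f x - integral_op k g x) %[ae mu].
Proof.
move=> k2 f2 g2; have := L2_section1 k2; apply: filterS => x kx _.
exact: innerBr.
Qed.

Lemma measurable_kernel_comp k k' : measurable_fun setT k ->
  measurable_fun setT k' -> measurable_fun setT (kernel_comp k k').
Proof.
move=> mk mk'; apply: (@measurable_Rintegral1 _ _ (T * T)%type _ _ mu
  (fun q => k (q.1.1, q.2) * k' (q.2, q.1.2))).
apply: measurable_funM.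
- apply: (measurableT_comp mk); apply/measurable_fun_pairP; split => /=.
    exact: (measurableT_comp measurable_fst measurable_fst).
  exact: measurable_snd.
- apply: (measurableT_comp mk'); apply/measurable_fun_pairP; split => /=.
    exact: measurable_snd.
  exact: (measurableT_comp measurable_snd measurable_fst).
Qed.

(** Cauchy-Schwarz in z dominates the square by a product of an integrable function of x and an
    integrable function of y. *)
Lemma L2_kernel_comp k k' : L2 pi k -> L2 pi k' -> L2 pi (kernel_comp k k').
Proof.
move=> k2 k'2.
apply: (@ae_le_L2 _ _ _ _ _
  (fun p => \int[mu]_z (k (p.1, z) ^+ 2) * \int[mu]_z (k' (z, p.2) ^+ 2))).
- exact: measurable_kernel_comp (L2_measurable k2) (L2_measurable k'2).
- apply: (@integrableR_tensor _ _ _ _ _ mu mu (fun x => \int[mu]_z (k (x, z) ^+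
    2))
    (fun y => \int[mu]_z (k' (z, y) ^+ 2))).
    exact: (integrableR_Rintegral1 (L2_sqr k2)).
  exact: (integrableR_Rintegral2 (L2_sqr k'2)).
have a1 := ae_fst mu (L2_section1 k2); have a2 := ae_snd mu (L2_section2 k'2).
apply: filterS2 a1 a2 => p p1 p2.
have := sqr_inner_le p1 p2; rewrite /inner.
by under [X in _ <= X * _ -> _]eq_Rintegral do rewrite -expr2;
  under [X in _ <= _ * X -> _]eq_Rintegral do rewrite -expr2.
Qed.

Lemma integral_op_comp k k' f : L2 pi k -> L2 pi k' -> L2 mu f ->
  integral_op k (integral_op k' f) = integral_op (kernel_comp k k') f %[ae mu].
Proof.
move=> k2 k'2 f2; have := L2_section1 k2; apply: filterS => x kx _.
rewrite -[LHS]/(inner mu (fun y => k (x, y)) (integral_op k' f)).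
(* With g = k(x, .), both sides equal the pairing of [k'] with g(z) f(y), so the exchange of
   integrals reduces to the two pairing lemmas. *)
rewrite (inner_integral_op k'2 f2 kx) -(inner_integral_op_tr k'2 f2 kx).
apply: eq_Rintegral => y _; rewrite mulrC; congr (_ * _).
by apply: eq_Rintegral => z _; rewrite mulrC.
Qed.

End integral_operators.

(** * Truncation of kernels *)

Lemma cvg0_exists_le (R : realType) (u : nat -> R) (e : R) : 0 < e ->
  u @ \oo --> 0 -> exists n, `|u n| <= e.
Proof.
move=> e0 /cvgr0Pnorm_le /(_ _ e0)[n _ H]; exists n; exact: (H n (leqnn n)).
Qed.

Lemma le0_of_le_geometric (R : realType) (a c : R) :
  (forall n, a <= c * 2^-1 ^+ n) -> a <= 0.
Proof.
move=> H; have c0 : geometric c 2^-1 @ \oo --> 0.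
  by apply: cvg_geometric; rewrite ger0_norm ?invr_ge0// invf_lt1// ltr1n.
by apply: (cvgr_to_ge c0); exact: nearW.
Qed.

Lemma Rintegral_dominated_cvg0 d (T : measurableType d) (R : realType)
    (mu : {measure set T -> \bar R}) (f : nat -> T -> R) (g : T -> R) :
  (forall n, measurable_fun setT (f n)) ->
  {ae mu, forall x, f ^~ x @ \oo --> 0} -> integrableR mu g ->
  {ae mu, forall x, forall n, `|f n x| <= g x} ->
  (fun n => \int[mu]_x f n x) @ \oo --> 0.
Proof.
move=> mf f0 Ig fg.
have [|||||_ _] := @dominated_convergence _ _ _ mu setT measurableT
  (fun n => EFin \o f n) (cst 0%E) (EFin \o g).
- by move=> n; apply/measurable_EFinP.
- exact: measurable_cst.
- by apply: filterS f0 => x fx _; exact: EFin_cvg.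
- exact: Ig.
- by apply: filterS fg => x fx n _; rewrite lee_fin.
by rewrite integral0 => /fine_cvg.
Qed.

Section integral_operators_L1.
Context d (T : measurableType d) (R : realType).
Variable mu : {finite_measure set T -> \bar R}.
Hypothesis mu1 : mu setT = 1%E.
Implicit Types (f g : T -> R) (k : T * T -> R).
Local Notation N2 := (L2norm mu).
Local Notation pi := (mu \x mu)%E.
Local Notation NN := (L2norm (mu \x mu)%E).

Lemma Rintegral_integral_op k f : L2 pi k -> L2 mu f ->
  \int[mu]_x integral_op mu k f x = \int[mu]_y (f y * \int[mu]_x k (x, y)).
Proof.
move=> k2 f2; have := integral_op_adjoint k2 f2 (L2_cst mu 1).
rewrite /inner; under eq_Rintegral do rewrite mulr1.
move=> ->; apply: eq_Rintegral => y _; congr (_ * _).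
by apply: eq_Rintegral => x _; rewrite mulr1.
Qed.

Lemma Rintegral_norm_integral_op_le k f : L2 pi k -> L2 mu f ->
  \int[mu]_x `|integral_op mu k f x| <=
  \int[mu]_y (`|f y| * \int[mu]_x `|k (x, y)|).
Proof.
move=> k2 f2; have nk2 := L2_normr k2; have nf2 := L2_normr f2.
rewrite -(Rintegral_integral_op nk2 nf2); apply: ae_le_Rintegral.
- by apply/integrableR_norm/L2_integrable; exact: L2_integral_op.
- by apply: L2_integrable; exact: L2_integral_op.
have := L2_section1 k2; apply: filterS => x kx.
rewrite /integral_op; under [leRHS]eq_Rintegral do rewrite -normrM.
by apply: le_normr_Rintegral => //; exact: L2_mul.
Qed.

(** This function is the transpose of |k| applied to the constant 1. *)
Lemma L2_Rintegral_norm k : L2 pi k -> L2 mu (fun y => \int[mu]_x `|k (x, y)|).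
Proof.
move=> k2; have := L2_integral_op (L2_kernel_tr (L2_normr k2)) (L2_cst mu 1).
congr L2; apply/funext => y; apply: eq_Rintegral => x _.
by rewrite mulr1.
Qed.

Lemma truncated_kernel_cvg0 k : L2 pi k ->
  (fun n => \int[pi]_p ((if `|k p| <= n%:R then 0 else k p) ^+ 2)) @ \oo --> 0.
Proof.
move=> k2; have mk := L2_measurable k2.
apply: Rintegral_dominated_cvg0 (L2_sqr k2) _.
- move=> n; apply: measurable_funX; apply: measurable_fun_ifT => //.
  by apply: measurable_fun_ler => //; exact: measurableT_comp.
- apply: aeW => p; apply: cvg_near_cst.
  exists (Num.truncn `|k p|).+1 => // n /= pn; rewrite ifT ?expr0n//.
  apply: ltW; apply: lt_le_trans (truncnS_gt _) _; rewrite ler_nat//.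
- apply: aeW => p n; rewrite ger0_norm ?sqr_ge0//; case: ifPn => // _.
  by rewrite expr0n sqr_ge0.
Qed.

(** The part [kt] of [k] where |k| > n has Hilbert-Schmidt norm at most e for a suitable n. The rest
    [kb] is bounded by n, so it sends f to a function bounded by n |f|_1, and on a space of mass 1
    this also bounds its L^2 norm. *)
Lemma integral_op_le_L2_L1 k (e : R) : 0 < e -> L2 pi k ->
  exists2 M, 0 <= M & forall f, L2 mu f ->
    N2 (integral_op mu k f) <= e * N2 f + M * \int[mu]_x `|f x|.
Proof.
move=> e0 k2; have mk := L2_measurable k2.
have [n] := cvg0_exists_le (exprn_gt0 2 e0) (truncated_kernel_cvg0 k2).
set kt := fun p => if `|k p| <= n%:R then 0 else k p => kte.
pose kb p := k p - kt p.
have kt2 : L2 pi kt.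
  apply: (ae_le_L2 _ (L2_sqr k2)).
    by apply: measurable_fun_ifT => //; apply: measurable_fun_ler => //;
      exact: measurableT_comp.
  by apply: aeW => p; rewrite /kt; case: ifP => // _; rewrite expr0n sqr_ge0.
have kb2 : L2 pi kb by exact: L2B.
have kbn p : `|kb p| <= n%:R.
  by rewrite /kb /kt; case: ifPn => [|_]; rewrite ?subr0// subrr normr0.
have ktN : NN kt <= e.
  rewrite -(@ler_pXn2r _ 2)// ?nnegrE ?L2norm_ge0 ?(ltW e0)// sqr_L2norm.
  apply: le_trans kte; rewrite ger0_norm; last first.
    by apply: Rintegral_ge0 => p _; rewrite sqr_ge0.
  by rewrite /inner; under eq_Rintegral do rewrite -expr2.
exists n%:R => // f f2.
have kE : integral_op mu k f = (fun x => integral_op mu kt f x + integral_op mu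
  kb f x) %[ae mu].
  have := L2_section1 kt2; have := L2_section1 kb2;
    apply: filterS2 => x kbx ktx _.
  rewrite /integral_op -RintegralD//;
    [|exact: L2_mul ktx f2|exact: L2_mul kbx f2].
  by apply: eq_Rintegral => y _; rewrite /kb -mulrDl addrC subrK.
have ktf := L2_integral_op kt2 f2; have kbf := L2_integral_op kb2 f2.
rewrite (ae_eq_L2norm (L2_integral_op k2 f2) (L2D ktf kbf) kE).
apply: le_trans (L2normD ktf kbf) _; apply: lerD.
  apply: le_trans (L2norm_integral_op_le kt2 f2) _.
  by rewrite ler_wpM2r// L2norm_ge0.
set M := n%:R * _; have M0 : 0 <= M by rewrite mulr_ge0// Rintegral_ge0.
have <- : N2 (cst M) = M by rewrite L2norm_cst// ger0_norm.
rewrite !L2normE; apply: ler_wsqrtr; apply: ae_le_Rintegral.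
- exact: L2_mul.
- exact: L2_mul (L2_cst mu M) (L2_cst mu M).
have := L2_section1 kb2; apply: filterS => x kbx.
rewrite -!expr2 -[leLHS]real_normK ?num_real// ler_pXn2r// ?nnegrE//.
apply: le_trans (le_normr_Rintegral _ _) _ => //; first exact: L2_mul.
rewrite /cst /M -RintegralZl//; last exact/integrableR_norm/L2_integrable.
apply: le_Rintegral => //.
- by apply: (@integrableR_norm _ _ _ mu (fun y => kb (x, y) * f y));
    exact: L2_mul.
- by apply/integrableRZ/integrableR_norm/L2_integrable.
- by move=> y _; rewrite normrM ler_wpM2r.
Qed.

End integral_operators_L1.

(** * Resolvent of a Markov operator *)

Section Markov_operator.
Context d (T : measurableType d) (R : realType).
Variable mu : {finite_measure set T -> \bar R}.
Hypothesis mu1 : mu setT = 1%E.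
Variables (k : T * T -> R) (f0 : T -> R).
Local Notation N2 := (L2norm mu).
Local Notation pi := (mu \x mu)%E.
Local Notation NN := (L2norm (mu \x mu)%E).
Local Notation L := (integral_op mu k).
Hypothesis k2 : L2 pi k.
Hypothesis k_ge0 : {ae pi, forall p, 0 <= k p}.
Hypothesis k_int1 : {ae mu, forall y, \int[mu]_x k (x, y) = 1}.
Hypothesis f02 : L2 mu f0.
Hypothesis f0_int1 : \int[mu]_x f0 x = 1.
Hypothesis L_cvg0 : forall g, L2 mu g -> \int[mu]_x g x = 0 ->
  (fun n => N2 (iter n L g)) @ \oo --> 0.
Implicit Types f g t : T -> R.

Let mk : measurable_fun setT k. Proof. exact: L2_measurable k2. Qed.

Lemma Rintegral_Markov f : L2 mu f -> \int[mu]_x L f x = \int[mu]_x f x.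
Proof.
move=> f2; rewrite Rintegral_integral_op//; apply: ae_eq_Rintegral.
- apply: measurable_funM; first exact: L2_measurable f2.
  exact: measurable_Rintegral2.
- exact: L2_measurable f2.
- by apply: filterS k_int1 => y -> _; rewrite mulr1.
Qed.

Lemma Rintegral_norm_Markov_le f : L2 mu f ->
  \int[mu]_x `|L f x| <= \int[mu]_x `|f x|.
Proof.
move=> f2; apply: le_trans (Rintegral_norm_integral_op_le k2 f2) _.
have mk' : measurable_fun setT (fun p => `|k p|) by exact: measurableT_comp.
rewrite le_eqVlt; apply/orP; left; apply/eqP; apply: ae_eq_Rintegral.
- apply: measurable_funM.
    by apply: measurableT_comp => //; exact: L2_measurable f2.
  exact: (measurable_Rintegral2 mu mk').
- by apply: measurableT_comp => //; exact: L2_measurable f2.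
have := ae_section2 k_ge0; apply: filterS2 k_int1 => y ky kpos _.
rewrite -[RHS]mulr1 -ky; congr (_ * _); apply: ae_eq_Rintegral.
- exact: (measurable_section2 y mk').
- exact: measurable_section2.
- by apply: filterS kpos => x kx _; rewrite ger0_norm.
Qed.

Lemma L2_iter_Markov n f : L2 mu f -> L2 mu (iter n L f).
Proof. by move=> f2; elim: n => //= n ih; exact: L2_integral_op. Qed.

Lemma Rintegral_iter_Markov n f : L2 mu f ->
  \int[mu]_x iter n L f x = \int[mu]_x f x.
Proof.
by move=> f2; elim: n => //= n <-; rewrite Rintegral_Markov//;
  exact: L2_iter_Markov.
Qed.

(** Subtracting f0(x) gives almost every fibre k(., y) - f0 zero mean, and does not change the
    action on functions of zero mean. *)
Definition centered_kernel (p : T * T) := k p - f0 p.1.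

(** Fibre by fibre, the n-th iterate of [centered_kernel]. On functions of zero mean it represents
    the power n + 1 of the operator, since the fibre itself accounts for one application. *)
Definition iter_kernel n (p : T * T) :=
  iter n L (fun x => centered_kernel (x, p.2)) p.1.

Lemma L2_centered_kernel : L2 pi centered_kernel.
Proof.
apply: L2B => //; have := L2_tensor f02 (L2_cst mu 1).
by under [X in L2 _ X -> _]eq_fun do rewrite mulr1.
Qed.

Lemma iter_kernelS n : iter_kernel n.+1 = kernel_comp mu k (iter_kernel n).
Proof. by apply/funext => -[x y]. Qed.

Lemma L2_iter_kernel n : L2 pi (iter_kernel n).
Proof.
elim: n => [|n ih]; last by rewrite iter_kernelS; exact: L2_kernel_comp.
rewrite (_ : iter_kernel 0 = centered_kernel); first exact: L2_centered_kernel.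
by apply/funext => -[x y].
Qed.

Lemma iter_Markov_kernel n t : L2 mu t -> \int[mu]_x t x = 0 ->
  iter n.+1 L t = integral_op mu (iter_kernel n) t %[ae mu].
Proof.
move=> t2 t0; elim: n => [|n ih].
  have := L2_section1 k2; apply: filterS => x kx _ /=.
  rewrite /integral_op /iter_kernel /centered_kernel/=.
  have If0t : integrableR mu (fun y => f0 x * t y) by
    exact/integrableRZ/L2_integrable.
  under [RHS]eq_Rintegral do rewrite mulrBl.
  rewrite RintegralB//; last exact: L2_mul kx t2.
  by rewrite RintegralZl ?t0 ?mulr0 ?subr0//; exact: L2_integrable.
have k2n := L2_iter_kernel n.
rewrite iterS (ae_eq_integral_op _ _ _ ih)//.
- by rewrite iter_kernelS; exact: integral_op_comp.
- exact: L2_measurable (L2_iter_Markov _ t2).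
- exact: L2_measurable (L2_integral_op k2n t2).
Qed.

Let b n y := \int[mu]_x `|iter_kernel n (x, y)|.

Let b2 n : L2 mu (b n). Proof. exact/L2_Rintegral_norm/L2_iter_kernel. Qed.

Lemma ae_centered_section :
  {ae mu, forall y, L2 mu (fun x => centered_kernel (x, y)) /\
                    \int[mu]_x centered_kernel (x, y) = 0}.
Proof.
have := L2_section2 k2; apply: filterS2 k_int1 => y ky1 ky2.
split; first exact: L2B.
rewrite /centered_kernel RintegralB ?ky1 ?f0_int1 ?subrr//.
- exact: L2_integrable ky2.
- exact: L2_integrable f02.
Qed.

(** [b n y] is the L^1 norm of the n-th iterate of a fibre of zero mean, so it tends to 0 for almost
    every y by A1. The L^1 contraction makes it nonincreasing in n, so the square-integrable [b 0]
    dominates. *)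
Lemma iter_kernel_cvg0 : (fun n => \int[mu]_y (b n y ^+ 2)) @ \oo --> 0.
Proof.
apply: Rintegral_dominated_cvg0 (L2_sqr (b2 0)) _.
- by move=> n; apply: measurable_funX; exact: L2_measurable (b2 n).
- have := ae_centered_section; apply: filterS => y [ky2 ky0].
  have := L_cvg0 ky2 ky0 => c0.
  have bc0 : b ^~ y @ \oo --> 0.
    apply: (@squeeze_cvgr _ _ _ _ (cst 0) (fun n => N2 (iter n L (fun x =>
      centered_kernel (x, y))))) => //.
    - near=> n; rewrite Rintegral_ge0//=.
      have := L1_le_L2 mu1 (L2_iter_Markov n ky2).
      by rewrite /b /iter_kernel /=.
    - exact: cvg_cst.
  have -> : (fun n => b n y ^+ 2) = (fun n => b n y * b n y).
    by apply/funext => n; rewrite expr2.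
  by rewrite -[X in _ --> X](mulr0 (0 : R)); exact: cvgM.
- have := ae_centered_section; apply: filterS => y [ky2 ky0] n.
  rewrite ger0_norm ?sqr_ge0// ler_pXn2r// ?nnegrE ?Rintegral_ge0//.
  elim: n => // n; apply: le_trans.
  have := Rintegral_norm_Markov_le (L2_iter_Markov n ky2).
  by rewrite /b /iter_kernel /=.
Unshelve. all: by end_near. Qed.

(** One n serves all t: the L^1 norm of the iterate is at most the integral of |t| [b n], and
    Cauchy-Schwarz in y separates the two factors. *)
Lemma Rintegral_norm_iter_Markov_le (e : R) : 0 < e ->
  exists n, forall t, L2 mu t -> \int[mu]_x t x = 0 ->
    \int[mu]_x `|iter n L t x| <= e * N2 t.
Proof.
move=> e0; have [n] := cvg0_exists_le (exprn_gt0 2 e0) iter_kernel_cvg0.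
rewrite ger0_norm; last by apply: Rintegral_ge0 => y _; rewrite sqr_ge0.
move=> bne.
have bN : N2 (b n) <= e.
  rewrite -(@ler_pXn2r _ 2)// ?nnegrE ?L2norm_ge0 ?(ltW e0)// sqr_L2norm.
  by rewrite /inner; under eq_Rintegral do rewrite -expr2.
(* The shift is that of [iter_kernel n], which represents the power n + 1. *)
exists n.+1 => t t2 t0.
have kt2 := L2_integral_op (L2_iter_kernel n) t2.
have it2 := L2_iter_Markov n.+1 t2.
rewrite (@ae_eq_Rintegral _ _ _ mu _ (fun x => `|integral_op mu (iter_kernel n)
  t x|)).
- apply: le_trans (Rintegral_norm_integral_op_le (L2_iter_kernel n) t2) _.
  rewrite mulrC; apply: le_trans (_ : _ <= N2 t * N2 (b n)) _; last first.
    by rewrite ler_wpM2l// L2norm_ge0.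
  apply: le_trans (Rintegral_normM_le t2 (b2 n)).
  rewrite le_eqVlt; apply/orP; left; apply/eqP; apply: eq_Rintegral => y _.
  by rewrite [X in _ = _ * X]ger0_norm// Rintegral_ge0.
- by apply: measurableT_comp => //; exact: L2_measurable it2.
- by apply: measurableT_comp => //; exact: L2_measurable kt2.
- by have := iter_Markov_kernel n t2 t0; apply: filterS => x /(_ I) ->.
Qed.

(** Telescoping t - L^n t: by the L^1 contraction each of the n increments has L^1 norm at most that
    of t - L t. *)
Lemma Rintegral_norm_dist_iter_le n t : L2 mu t ->
  \int[mu]_x `|t x| <=
  n%:R * \int[mu]_x `|t x - L t x| + \int[mu]_x `|iter n L t x|.
Proof.
move=> t2; pose D n := \int[mu]_x `|iter n L t x - iter n.+1 L t x|.
have it2 m := L2_iter_Markov m t2.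
have DS m : D m.+1 <= D m.
  have dd := L2B (it2 m) (it2 m.+1).
  apply: le_trans (Rintegral_norm_Markov_le dd).
  rewrite le_eqVlt; apply/orP; left; apply/eqP; apply: ae_eq_Rintegral.
  - by apply: measurableT_comp => //;
      exact: L2_measurable (L2B (it2 m.+1) (it2 m.+2)).
  - by apply: measurableT_comp => //;
      exact: L2_measurable (L2_integral_op k2 dd).
  by have := integral_opB k2 (it2 m) (it2 m.+1); apply: filterS => x /(_ I) ->.
have D0 m : D m <= D 0%N by elim: m => // m; exact: le_trans.
elim: n => [|n ih]; first by rewrite mul0r add0r.
apply: le_trans ih _; rewrite -natr1 mulrDl mul1r -addrA lerD2l.
apply: le_trans (_ : _ <= D n + \int[mu]_x `|iter n.+1 L t x|) _; last first.
  by rewrite lerD2r; exact: D0.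
have I1 : integrableR mu (fun x => `|iter n L t x - iter n.+1 L t x|).
  apply: (@integrableR_norm _ _ _ mu (fun x => iter n L t x - iter n.+1 L t x)).
  exact: L2_integrable (L2B (it2 n) (it2 n.+1)).
have I2 : integrableR mu (fun x => `|iter n.+1 L t x|).
  exact: integrableR_norm (L2_integrable (it2 n.+1)).
rewrite -RintegralD//; apply: le_Rintegral => //.
- exact: integrableR_norm (L2_integrable (it2 n)).
- exact: integrableRD.
- by move=> x _; rewrite -[X in `|X| <= _](subrK (iter n.+1 L t x)) ler_normD.
Qed.

(** The tolerances 1/4 and 1/(4 (M + 1)) each leave at most |t|_2 / 4 on the right, the second after
    multiplication by M. Absorbing these into the left-hand side doubles the remaining 1 + M n,
    which gives C. Using M + 1 keeps the denominator positive when M = 0. *)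
Lemma id_minus_Markov_bounded_below :
  exists2 C, 0 <= C & forall t, L2 mu t -> \int[mu]_x t x = 0 ->
    N2 t <= C * N2 (id_minus L t).
Proof.
have [M M0 HM] := integral_op_le_L2_L1 mu1 (e := 4^-1) (ltac:(by rewrite
  invr_gt0)) k2.
have M1 : 0 < 4 * (M + 1) by rewrite mulr_gt0// ltr_wpDl.
have [n Hn] := @Rintegral_norm_iter_Markov_le (4 * (M + 1))^-1 (ltac:(by
  rewrite invr_gt0)).
exists (2 * (1 + M * n%:R)) => [|t t2 t0];
  first by rewrite mulr_ge0// addr_ge0// mulr_ge0.
have Lt2 := L2_integral_op k2 t2.
have d2 := L2B t2 Lt2.
have h1 : N2 t <= N2 (id_minus L t) + N2 (L t).
  have := L2normD d2 Lt2.
  by under [X in N2 X <= _ -> _]eq_fun do rewrite subrK.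
have h2 := HM _ t2.
have h3 := Rintegral_norm_dist_iter_le n t2.
have h4 := Hn _ t2 t0.
have h5 : \int[mu]_x `|t x - L t x| <= N2 (id_minus L t) by exact: L1_le_L2.
have h6 : M * (4 * (M + 1))^-1 <= 4^-1.
  rewrite invfM mulrCA ler_piMr// ler_pdivrMr ?ltr_wpDl//; lra.
set a := N2 t in h1 h2 h4 *; set q := N2 (id_minus L t) in h1 h5 *.
have a0 : 0 <= a by exact: L2norm_ge0.
have h7 : M * \int[mu]_x `|t x| <= M * (n%:R * q + (4 * (M + 1))^-1 * a).
  apply: ler_wpM2l => //; apply: le_trans h3 _; apply: lerD => //.
  exact: ler_wpM2l.
have h8 : M * (n%:R * q + (4 * (M + 1))^-1 * a) <= M * n%:R * q + 4^-1 * a.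
  by rewrite mulrDr !mulrA lerD2l ler_wpM2r.
rewrite -mulrA mulrDl mul1r.
lra.
Qed.

(** * Neumann sums and solvability on functions of zero mean *)

Definition Neumann_sum n g : T -> R := fun x => \sum_(j < n) iter j L g x.

Lemma Neumann_sumP n g : L2 mu g -> \int[mu]_x g x = 0 ->
  [/\ L2 mu (Neumann_sum n g), \int[mu]_x Neumann_sum n g x = 0 &
  id_minus L (Neumann_sum n g) = (fun x => g x - iter n L g x) %[ae mu]].
Proof.
move=> g2 g0; elim: n => [|n [s2 s0 sE]].
  have -> : Neumann_sum 0 g = cst 0 by apply/funext => x;
    rewrite /Neumann_sum big_ord0.
  split; [exact: L2_cst|by rewrite Rintegral_cst1|].
  apply: aeW => x _; rewrite /id_minus /integral_op subrr /=.
  by under eq_Rintegral do rewrite mulr0; rewrite Rintegral_cst1// subrr.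
have E : Neumann_sum n.+1 g = (fun x => Neumann_sum n g x + iter n L g x).
  by apply/funext => x; rewrite /Neumann_sum big_ord_recr.
have ig2 := L2_iter_Markov n g2.
split; rewrite E; first exact: L2D.
- by rewrite RintegralD// ?s0 ?add0r ?Rintegral_iter_Markov//;
    exact: L2_integrable.
- have := integral_opD k2 s2 ig2; apply: filterS2 sE => x /(_ I) + /(_ I).
  rewrite /id_minus /= => sE ->; rewrite opprD addrACA sE.
  by rewrite addrA subrK.
Qed.

Lemma id_minus_Markov_surjective g : L2 mu g -> \int[mu]_x g x = 0 ->
  exists u, [/\ L2 mu u, \int[mu]_x u x = 0 & id_minus L u = g %[ae mu]].
Proof.
move=> g2 g0; have [C C0 HC] := id_minus_Markov_bounded_below.
have Lg0 := L_cvg0 g2 g0.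
(* Chosen so that C (e_i + e_(i+1)) <= (C + 1) 2 e_i = 2^-i, the rate that [L2_complete] asks
   for. *)
pose e i : R := 2^-1 ^+ i / (2 * (C + 1)).
have C1 : 0 < 2 * (C + 1) by rewrite mulr_gt0// ltr_wpDl.
have e0 i : 0 < e i by rewrite divr_gt0// exprn_gt0// invr_gt0.
(* The indices [n i] need not increase: the distance between two Neumann sums is controlled by their
   residuals L^(n i) g alone. *)
have /choice[n Hn] : forall i, exists n, N2 (iter n L g) <= e i.
  move=> i.
  have [n] := cvg0_exists_le (e0 i) Lg0.
  by rewrite ger0_norm ?L2norm_ge0//; exists n.
pose s i := Neumann_sum (n i) g.
have sP i : [/\ L2 mu (s i), \int[mu]_x s i x = 0 &
  id_minus L (s i) = (fun x => g x - iter (n i) L g x) %[ae mu]] by exact: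
    Neumann_sumP.
have s2 i : L2 mu (s i) by case: (sP i).
have i2 i := L2_iter_Markov (n i) g2.
have [|u u2 Hu] := L2_complete mu1 s2.
  move=> i; have [_ a0 aE] := sP i.+1; have [_ c0 cE] := sP i.
  have ds2 := L2B (s2 i.+1) (s2 i).
  have ds0 : \int[mu]_x (s i.+1 x - s i x) = 0.
    by rewrite RintegralB ?a0 ?c0 ?subrr//; exact: L2_integrable.
  apply: le_trans (HC _ ds2 ds0) _.
  have LE : id_minus L (fun x => s i.+1 x - s i x) =
      (fun x => iter (n i) L g x - iter (n i.+1) L g x) %[ae mu].
    have := integral_opB k2 (s2 i.+1) (s2 i).
    apply: filterS3 aE cE => x /(_ I) + /(_ I) + /(_ I).
    rewrite /id_minus => aE cE -> _.
    have -> : s i.+1 x - s i x - (L (s i.+1) x - L (s i) x) =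
      (s i.+1 x - L (s i.+1) x) - (s i x - L (s i) x) by ring.
    by rewrite aE cE; ring.
  rewrite (ae_eq_L2norm _ _ LE); last first.
  - exact: L2B.
  - exact: L2B (L2_integral_op k2 ds2).
  have h : N2 (fun x => iter (n i) L g x - iter (n i.+1) L g x) <= e i + e i.+1.
    by apply: le_trans (L2norm_sub_le (i2 i) (i2 i.+1)) _; exact: lerD.
  apply: le_trans (ler_wpM2l C0 h) _.
  have ei : e i.+1 <= e i.
    by rewrite /e exprS ler_pM2r ?invr_gt0// ger_pMl ?exprn_gt0 ?invr_gt0//
      invf_le1// ler1n.
  apply: le_trans (_ : _ <= (C + 1) * (2 * e i)) _.
    by apply: ler_pM => //; [rewrite addr_ge0// ltW|rewrite lerDl|lra].
  rewrite /e le_eqVlt; apply/orP; left; apply/eqP; field.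
  by rewrite gt_eqF// ltr_wpDl.
have Lu2 := L2_integral_op k2 u2.
exists u; split => //.
(* Each s_i has zero mean, so the mean of u is that of u - s_i, which is at most 2 * 2^-i in
   absolute value. *)
- apply/eqP; rewrite -normr_le0; apply: (@le0_of_le_geometric _ _ 2) => i.
  apply: le_trans (Hu i); rewrite L2normBC.
  apply: le_trans (L1_le_L2 mu1 (L2B u2 (s2 i))).
  have [_ si0 _] := sP i.
  have -> : \int[mu]_x u x = \int[mu]_x (u x - s i x).
    by rewrite RintegralB ?si0 ?subr0//; exact: L2_integrable.
  by apply: le_normr_Rintegral => //; apply: L2_integrable; exact: L2B.
- have r2 : L2 mu (fun x => id_minus L u x - g x) by exact: L2B (L2B u2 Lu2) g2.
  have r0 : N2 (fun x => id_minus L u x - g x) = 0.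
    apply/eqP; rewrite eq_le L2norm_ge0 andbT.
    (* The residual of u is (Id - L)(u - s_i) - L^(n i) g. The three summands of the constant bound
       u - s_i, its image under L, and L^(n i) g, each in units of 2^-i. *)
    apply: (@le0_of_le_geometric _ _ (2 + 2 * NN k + (2 * (C + 1))^-1)) => i.
    have [_ _ sE] := sP i.
    have us2 := L2B u2 (s2 i); have Lus2 := L2_integral_op k2 us2.
    have E : (fun x => id_minus L u x - g x) =
        (fun x => (id_minus L (fun x => u x - s i x) x) - iter (n i) L g x)
          %[ae mu].
      have := integral_opB k2 u2 (s2 i);
        apply: filterS2 sE => x /(_ I) + /(_ I).
      rewrite /id_minus => sE -> _.
      have -> : u x - s i x - (L u x - L (s i) x) = u x - L u x - (s i x - L (s
        i) x) by ring.
      by rewrite sE; ring.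
    rewrite (ae_eq_L2norm r2 _ E); last exact: L2B (L2B us2 Lus2) (i2 i).
    have hu := Hu i; rewrite L2normBC in hu.
    have h1 := L2norm_sub_le us2 Lus2.
    have h2 := L2norm_integral_op_le k2 us2.
    apply: le_trans (L2norm_sub_le (L2B us2 Lus2) (i2 i)) _.
    have h3 := Hn i; rewrite /e in h3.
    have h4 : NN k * N2 (fun x => u x - s i x) <= NN k * (2 * 2^-1 ^+ i).
      by rewrite ler_wpM2l// L2norm_ge0.
    move: h1 h2 h3 h4 hu; rewrite /id_minus.
    set A := N2 _; set B := N2 _; set C' := N2 _; set D := N2 _;
      set q := 2^-1 ^+ i.
    move=> h1 h2 h3 h4 hu.
    apply: le_trans (lerD h1 h3) _;
      rewrite [leRHS]mulrDl [X in _ <= _ + X]mulrC.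
    rewrite lerD2r mulrDl; apply: lerD => //.
    by apply: le_trans h2 _; apply: le_trans h4 _; rewrite mulrCA mulrA.
  have := L2norm_eq0 r2 r0; apply: filterS => x /(_ I) /eqP + _.
  by rewrite subr_eq0 => /eqP.
Qed.

End Markov_operator.

(** * Centring along the fibres of a set *)

Section Linfty_functions.
Context d (T : measurableType d) (R : realType).
Variable mu : {measure set T -> \bar R}.
Hypothesis mu_gt0 : (0 < mu setT)%E.

Lemma LinftyP (f : T -> R) : Linfty mu f <->
  measurable_fun setT f /\ exists M, {ae mu, forall x, `|f x| <= M}.
Proof.
split=> [/andP[]|[mf [M fM]]].
  rewrite !inE/= /finite_norm unlock mu_gt0 => mf fy; split => //.
  exact: (ess_supr_bounded fy).
apply/andP; rewrite !inE/= /finite_norm unlock mu_gt0; split => //.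
apply: (@le_lt_trans _ _ M%:E); last exact: ltry.
by apply/ess_supP; apply: filterS fM => x; rewrite lee_fin.
Qed.

Lemma ae_eq_Linfty (f g : T -> R) : measurable_fun setT g ->
  f = g %[ae mu] -> Linfty mu f -> Linfty mu g.
Proof.
move=> mg fg /LinftyP[_ [M fM]]; apply/LinftyP; split => //; exists M.
by apply: filterS2 fg fM => x /(_ I) ->.
Qed.

Lemma LinftyD (f g : T -> R) : Linfty mu f -> Linfty mu g ->
  Linfty mu (fun x => f x + g x).
Proof.
move=> /LinftyP[mf [A fA]] /LinftyP[mg [B gB]]; apply/LinftyP; split.
  exact: measurable_funD.
exists (A + B); apply: filterS2 fA gB => x fA gB.
exact: le_trans (ler_normD _ _) (lerD fA gB).
Qed.

Lemma LinftyZ a (f : T -> R) : Linfty mu f -> Linfty mu (fun x => a * f x).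
Proof.
move=> /LinftyP[mf [A fA]]; apply/LinftyP; split; first exact: measurable_funM.
by exists (`|a| * A); apply: filterS fA => x fA; rewrite normrM ler_wpM2l.
Qed.

End Linfty_functions.

Lemma product_measure_gt0 d (T : measurableType d) (R : realType)
    (mu : {finite_measure set T -> \bar R}) :
  (0 < mu setT)%E -> (0 < (mu \x mu) setT)%E.
Proof. by move=> mu0; rewrite -setXTT [ltRHS]product_measure1E// mule_gt0. Qed.

Section fibrewise_centering.
Context d (T : measurableType d) (R : realType).
Variable mu : {finite_measure set T -> \bar R}.
Variables (F : set (T * T)) (f0 h : T -> R).
Local Notation N2 := (L2norm mu).
Local Notation pi := (mu \x mu)%E.
Local Notation NN := (L2norm (mu \x mu)%E).
Hypothesis mF : measurable F.
Hypotheses (f02 : L2 mu f0) (h2 : L2 mu h).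
Implicit Types k : T * T -> R.

Definition fibre_mean y : R :=
  (\int[mu]_(z in ysection F y) h z) / fine (mu (ysection F y)).

Definition centered_tensor (p : T * T) : R :=
  if p \in F then f0 p.2 * (h p.1 - fibre_mean p.2) else 0.

Let m y := fine (mu (ysection F y)).
Let ind (p : T * T) : R := \1_F p.

Let mind : measurable_fun setT ind. Proof. exact: measurable_indic. Qed.

Let mh : measurable_fun setT h. Proof. exact: L2_measurable h2. Qed.

Let ind_sqr p : ind p ^+ 2 = ind p.
Proof. by rewrite /ind indicE; case: (p \in F); rewrite ?expr1n ?expr0n. Qed.

Lemma Rintegral_ysection g y :
  \int[mu]_(x in ysection F y) g x = \int[mu]_x (\1_F (x, y) * g x).
Proof.
rewrite Rintegral_mkcond; apply: eq_Rintegral => x _.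
rewrite patchE mem_ysection indicE; case: ifPn => _; rewrite ?mul1r ?mul0r//.
Qed.

Lemma fine_measure_ysection y : m y = \int[mu]_x \1_F (x, y).
Proof.
rewrite /m -[LHS]mul1r -Rintegral_cst; last exact: measurable_ysection.
by rewrite Rintegral_ysection; apply: eq_Rintegral => x _; rewrite mulr1.
Qed.

Let L2_ind y : L2 mu (fun x => ind (x, y)).
Proof.
apply: (ae_le_L2 _ (L2_integrable (L2_cst mu 1))).
  exact: measurable_section2.
by apply: aeW => x; rewrite ind_sqr /ind indicE; case: (_ \in F).
Qed.

Let m_ge0 y : 0 <= m y. Proof. by rewrite /m fine_ge0. Qed.

Lemma sqr_Rintegral_ysection_le y :
  (\int[mu]_(x in ysection F y) h x) ^+ 2 <= m y * N2 h ^+ 2.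
Proof.
rewrite Rintegral_ysection; have := sqr_inner_le (L2_ind y) h2.
rewrite -(sqr_L2norm mu h) {2}/inner.
under [X in _ <= X * _ -> _]eq_Rintegral do rewrite -expr2 ind_sqr.
by rewrite -fine_measure_ysection.
Qed.

(** On a null fibre the quotient is 0 by convention, and the integral is 0 by the preceding bound,
    so later computations need no case distinction. *)
Lemma fibre_meanM y : fibre_mean y * m y = \int[mu]_(x in ysection F y) h x.
Proof.
have [m0|mN0] := eqVneq (m y) 0; last by rewrite /fibre_mean divfK.
rewrite m0 mulr0; apply/esym/eqP; rewrite -sqrf_eq0 eq_le sqr_ge0 andbT.
by rewrite (le_trans (sqr_Rintegral_ysection_le y))// m0 mul0r.
Qed.

(** The mean alone may be unbounded as fibres shrink; weighted by the measure of the fibre, its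
    square is bounded uniformly in y. *)
Lemma sqr_fibre_mean_le y : fibre_mean y ^+ 2 * m y <= N2 h ^+ 2.
Proof.
have [m0|mN0] := eqVneq (m y) 0; first by rewrite m0 mulr0 sqr_ge0.
have mp : 0 < m y by rewrite lt_neqAle eq_sym mN0 m_ge0.
rewrite -(ler_pM2r mp) -mulrA -expr2 -exprMn fibre_meanM [leRHS]mulrC.
exact: sqr_Rintegral_ysection_le.
Qed.

Lemma measurable_fibre_mean : measurable_fun setT fibre_mean.
Proof.
(* Writing the inverse as a power allows the use of the measurability of powers; both conventions
   give 0 at 0. *)
have -> : fibre_mean = (fun y => (\int[mu]_x (ind (x, y) * h x)) * (\int[mu]_x
  ind (x, y)) `^ (-1)).
  apply/funext => y;
    rewrite /fibre_mean Rintegral_ysection -/(m y) fine_measure_ysection.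
  by rewrite powR_inv1// -fine_measure_ysection.
apply: measurable_funM.
  apply: (@measurable_Rintegral2 _ _ _ _ _ mu (fun p => ind p * h p.1)).
  by apply: measurable_funM => //; exact: measurableT_comp.
by apply: (measurableT_comp (measurable_powR _)); exact: measurable_Rintegral2.
Qed.

(** The term subtracted in [centered_tensor]; along each fibre it is a constant multiple of the
    indicator. *)
Let r (p : T * T) : R := ind p * (f0 p.2 * fibre_mean p.2).

Let mr : measurable_fun setT r.
Proof.
apply: measurable_funM => //.
apply: (@measurableT_comp _ _ _ _ _ _ (fun y => f0 y * fibre_mean y)) => //.
apply: measurable_funM; first exact: L2_measurable f02.
exact: measurable_fibre_mean.
Qed.

(** Integrating r^2 over x first gives f0(y)^2 times the quantity of [sqr_fibre_mean_le], hence at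
    most |h|^2 f0(y)^2, which is integrable in y. *)
Let L2r : L2 pi r.
Proof.
apply/L2P; split => //; apply/integrable21ltyP.
  by apply/measurable_EFinP; exact: measurable_funX.
apply: (@le_lt_trans _ _ (\int[mu]_y (N2 h ^+ 2 * f0 y ^+ 2)%:E)%E); last first.
  have /integrableP[_] : integrableR mu (fun y => N2 h ^+ 2 * f0 y ^+ 2).
    exact/integrableRZ/L2_sqr.
  apply: le_lt_trans; apply: ge0_le_integral => //.
  - by move=> y _; rewrite lee_fin mulr_ge0 ?sqr_ge0.
  - apply/measurable_EFinP; apply: measurable_funM => //.
    by apply: measurable_funX; exact: L2_measurable f02.
  - apply: measurableT_comp => //; apply/measurable_EFinP;
      apply: measurable_funM => //.
    by apply: measurable_funX; exact: L2_measurable f02.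
  - by move=> y _; exact: lee_abs.
apply: ge0_le_integral => //.
- by move=> y _; exact: integral_ge0.
- apply: (measurable_fun_fubini_tonelli_G (fun p => `|(r p ^+ 2)%:E|%E)).
    by apply: measurableT_comp => //; apply/measurable_EFinP;
      exact: measurable_funX.
  by move=> p; exact: abse_ge0.
- apply/measurable_EFinP; apply: measurable_funM => //.
  by apply: measurable_funX; exact: L2_measurable f02.
move=> y _.
have Iy : integrableR mu (fun x => (f0 y * fibre_mean y) ^+ 2 * ind (x, y)).
  exact/integrableRZ/L2_integrable.
rewrite (_ : integral _ _ _ = (\int[mu]_x ((f0 y * fibre_mean y) ^+ 2 * ind (x,
  y)))%:E).
  rewrite lee_fin RintegralZl//; last exact/L2_integrable.
  rewrite -fine_measure_ysection exprMn -mulrA mulrC ler_wpM2r ?sqr_ge0//.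
  exact: sqr_fibre_mean_le.
rewrite Rintegral_EFin//; apply: eq_integral => x _ /=.
by rewrite ger0_norm ?sqr_ge0// /r exprMn ind_sqr mulrC.
Qed.

Let q (p : T * T) : R := h p.1 * f0 p.2.

Let L2q : L2 pi q. Proof. exact: L2_tensor. Qed.

Lemma centered_tensorE p :
  centered_tensor p = \1_F p * (h p.1 * f0 p.2) - \1_F p * (f0 p.2 * fibre_mean
    p.2).
Proof.
rewrite /centered_tensor indicE; case: ifPn => _;
  rewrite ?mul1r ?mul0r ?subrr//.
by ring.
Qed.

Lemma L2_centered_tensor : L2 pi centered_tensor.
Proof.
have -> : centered_tensor = (fun p => ind p * q p - r p).
  by apply/funext => p; rewrite centered_tensorE.
apply: L2B => //; apply: (ae_le_L2 _ (L2_sqr L2q)).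
  by apply: measurable_funM => //; exact: L2_measurable L2q.
apply: aeW => p; rewrite exprMn ind_sqr /ind indicE.
by case: (p \in F); rewrite ?mul1r// mul0r sqr_ge0.
Qed.

Lemma Rintegral_centered_tensor y : \int[mu]_x centered_tensor (x, y) = 0.
Proof.
have Ih : integrableR mu (fun x => ind (x, y) * h x) by exact: L2_mul (L2_ind
  y) h2.
have Ii : integrableR mu (fun x => ind (x, y)) by exact/L2_integrable.
under eq_Rintegral do rewrite centered_tensorE/=.
have -> : \int[mu]_x (ind (x, y) * (h x * f0 y) - ind (x, y) * (f0 y *
  fibre_mean y)) =
  \int[mu]_x (f0 y * (ind (x, y) * h x) - (f0 y * fibre_mean y) * ind (x, y)).
  by apply: eq_Rintegral => x _; ring.
rewrite RintegralB//; [|exact: integrableRZ|exact: integrableRZ].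
rewrite !RintegralZl// -Rintegral_ysection -fine_measure_ysection -mulrA.
by rewrite fibre_meanM subrr.
Qed.

Lemma centered_tensor_out p : ~ F p -> centered_tensor p = 0.
Proof. by move=> Fp; rewrite /centered_tensor memNset. Qed.

(* The two kernels differ by [f0 y * fibre_mean y] on F, to which a kernel that
   is supported in F and has fibres of zero mean is orthogonal. *)
Lemma inner_centered_tensor k : L2 pi k ->
  {ae mu, forall y, \int[mu]_x k (x, y) = 0} ->
  {ae pi, forall p, ~ F p -> k p = 0} ->
  inner pi k (fun p => h p.1 * f0 p.2) = inner pi k centered_tensor.
Proof.
move=> k2 ky kF; have P2 := L2_centered_tensor.
have mk := L2_measurable k2.
have -> : inner pi k (fun p => h p.1 * f0 p.2) =
    inner pi k (fun p => centered_tensor p + r p).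
  apply: ae_eq_Rintegral.
  - by apply: measurable_funM => //; exact: L2_measurable L2q.
  - by apply: measurable_funM => //; exact: L2_measurable (L2D P2 L2r).
  apply: filterS kF => p kp _; rewrite centered_tensorE subrK indicE.
  have [Fp|Fp] := pselect (F p); first by rewrite mem_set// mul1r.
  by rewrite kp ?mul0r.
rewrite innerDr// [X in _ + X](_ : _ = 0) ?addr0//.
rewrite /inner (Rintegral_Fubini2 (L2_mul k2 L2r)).
rewrite (@ae_eq_Rintegral _ _ _ mu _ (cst 0)) ?Rintegral_cst ?mul0r//.
  exact/integrableR_measurable/(integrableR_Rintegral2 (L2_mul k2 L2r)).
have := ae_section2 kF; have := L2_section2 k2;
  apply: filterS3 ky => y k0 ky2 kFy _.
rewrite (@ae_eq_Rintegral _ _ _ mu _ (fun x => (f0 y * fibre_mean y) * k (x,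
  y))).
- by rewrite RintegralZl ?k0 ?mulr0//; exact: L2_integrable.
- by apply: measurable_funM;
    [exact: L2_measurable ky2|exact: measurable_section2].
- by apply: measurable_funM => //; exact: L2_measurable ky2.
apply: filterS kFy => x kx _; rewrite /r /ind indicE /=.
have [Fp|Fp] := pselect (F (x, y)); first by rewrite mem_set// mul1r mulrC.
by rewrite kx// !(mul0r, mulr0).
Qed.

(** If the kernel vanished, some y in [X] would have h almost everywhere equal to its mean on the
    fibre, because f0(y) > 0. Then h would have a constant sign there, and its positive or its
    negative part would integrate to 0. *)
Lemma L2norm_centered_tensor_gt0 (X : set T) : measurable X -> (0 < mu X)%E ->
  (forall y, X y -> [/\ 0 < f0 y, 0 < \int[mu]_(x in ysection F y) h^\+ x &
                        0 < \int[mu]_(x in ysection F y) h^\- x]) ->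
  0 < NN centered_tensor.
Proof.
move=> mX X0 HX; rewrite lt_neqAle L2norm_ge0 andbT; apply/negP => /eqP/esym P0.
have /ae_section2 : {ae pi, forall p, centered_tensor p = 0}.
  by have := L2norm_eq0 L2_centered_tensor P0; apply: filterS => p /(_ I).
move=> [N [mN N0 PN]].
have [y [Xy Ny]] : exists y, X y /\ ~ N y.
  apply: contrapT => /forallNP H.
  have : (mu X <= mu N)%E.
    apply: le_measure; rewrite ?inE//.
    by move=> y Xy; apply: contrapT => Ny; apply: (H y).
  by rewrite N0 leNgt X0.
have {}PN : {ae mu, forall x, centered_tensor (x, y) = 0}.
  by apply: contrapT => H; apply: Ny; exact: PN.
have [f0y hp hn] := HX _ Xy.
(* Since h is constant on the fibre up to a null set, so is g o h. This is used with g the positive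
   part and with g the negative part. *)
have hE (g : R -> R) : measurable_fun setT (g \o h) ->
    \int[mu]_(x in ysection F y) g (h x) = g (fibre_mean y) * m y.
  move=> mg; rewrite fine_measure_ysection -RintegralZl//;
    last exact: (L2_integrable (L2_ind y)).
  rewrite Rintegral_ysection; apply: ae_eq_Rintegral.
  - by apply: measurable_funM => //; exact: measurable_section2 mind.
  - by apply: measurable_funM => //; exact: measurable_section2 mind.
  apply: filterS PN => x + _; rewrite /centered_tensor indicE.
  case: (_ \in F) => /=; last by rewrite mul0r mulr0.
  move=> /eqP; rewrite mulf_eq0 gt_eqF//= subr_eq0 => /eqP ->.
  by rewrite mulrC.
have mp : measurable_fun setT (fun x => Num.max (h x) 0).
  by apply: measurable_maxr.
have mn : measurable_fun setT (fun x => Num.max (- h x) 0).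
  by apply: measurable_maxr => //; exact: measurableT_comp.
have := hE (fun t => Num.max t 0) mp; have := hE (fun t => Num.max (- t) 0) mn.
move=> Hn Hp; move: hp hn.
rewrite [X in 0 < X -> _]Hp [X in _ -> 0 < X -> _]Hn.
have [h0|h0] := leP (fibre_mean y) 0; first by rewrite mul0r ltxx.
by move=> _; rewrite (max_idPr _) ?mul0r ?ltxx// oppr_le0 ltW.
Qed.

Lemma Linfty_centered_tensor : (0 < mu setT)%E ->
  Linfty mu f0 -> Linfty mu h -> Linfty pi centered_tensor.
Proof.
move=> mu0 /(LinftyP mu0)[_ [A fA]] /(LinftyP mu0)[_ [B hB]].
apply/(LinftyP (product_measure_gt0 mu0)).
split; first exact: L2_measurable L2_centered_tensor.
(* The essential bounds A and B are not known to be nonnegative, hence the absolute values. A null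
   fibre has mean 0 by convention. *)
have mB y : `|fibre_mean y| <= `|B|.
  have [m0|mN0] := eqVneq (m y) 0.
    by rewrite /fibre_mean -/(m y) m0 invr0 mulr0 normr0.
  have mp : 0 < m y by rewrite lt_neqAle eq_sym mN0 m_ge0.
  rewrite /fibre_mean -/(m y) normrM normfV (ger0_norm (m_ge0 y)) ler_pdivrMr//.
  rewrite Rintegral_ysection.
  have Ih : integrableR mu (fun x => ind (x, y) * h x) by exact: L2_mul (L2_ind
    y) h2.
  apply: le_trans (le_normr_Rintegral measurableT Ih) _.
  rewrite fine_measure_ysection -RintegralZl//;
    last exact: (L2_integrable (L2_ind y)).
  apply: ae_le_Rintegral.
  - exact: (integrableR_norm Ih).
  - exact/integrableRZ/(L2_integrable (L2_ind y)).
  apply: filterS hB => x hx; rewrite normrM mulrC.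
  rewrite [X in _ * X]ger0_norm; last by rewrite /ind indicE; case: (_ \in F).
  apply: ler_wpM2r; first by rewrite /ind indicE; case: (_ \in F).
  by apply: le_trans hx _; exact: ler_norm.
exists (`|A| * (`|B| + `|B|)).
have h1 := ae_snd mu fA; have h3 := ae_fst mu hB;
  apply: filterS2 h1 h3 => p fp hp.
rewrite /centered_tensor; case: ifPn => _;
  last by rewrite normr0 mulr_ge0// addr_ge0.
rewrite normrM; apply: ler_pM => //; first exact: le_trans fp (ler_norm _).
apply: le_trans (ler_normB _ _) _; apply: lerD; last exact: mB.
exact: le_trans hp (ler_norm _).
Qed.

End fibrewise_centering.

(** * The optimisation problem *)

Section adjoints_and_bounds.
Context d (T : measurableType d) (R : realType).
Variable mu : {finite_measure set T -> \bar R}.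
Implicit Types (f g : T -> R) (k : T * T -> R).
Local Notation pi := (mu \x mu)%E.

(** [adjoint] is a choice; the operator of the transposed kernel shows that there is something to
    choose, so the chosen function satisfies the specification. *)
Lemma adjointP k g : L2 pi k -> L2 mu g ->
  L2 mu (adjoint mu (integral_op mu k) g) /\
  forall f, L2 mu f -> inner mu (integral_op mu k f) g =
                       inner mu f (adjoint mu (integral_op mu k) g).
Proof.
move=> k2 g2; apply: (@xgetPex _ (cst 0) [set h | L2 mu h /\
  forall f, L2 mu f -> inner mu (integral_op mu k f) g = inner mu f h]).
exists (integral_op mu (kernel_tr k) g); split.
  exact: L2_integral_op (L2_kernel_tr k2) g2.
by move=> f f2; exact: integral_op_adjoint.
Qed.

(** Both functions have the same pairing with every square-integrable function, in particular with
    their difference. *)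
Lemma adjoint_integral_op k g : L2 pi k -> L2 mu g ->
  adjoint mu (integral_op mu k) g = integral_op mu (kernel_tr k) g %[ae mu].
Proof.
move=> k2 g2; have [a2 aE] := adjointP k2 g2.
have t2 := L2_integral_op (L2_kernel_tr k2) g2.
have d2 := L2B a2 t2.
have := inner_eq0 d2; rewrite innerBr// -aE// integral_op_adjoint// subrr.
by move=> /(_ erefl); apply: filterS => x /(_ I) /eqP + _;
  rewrite subr_eq0 => /eqP.
Qed.

Hypothesis mu_gt0 : (0 < mu setT)%E.

(** The bound is asked for section by section, a form that [ae_section1] supplies for a bounded
    kernel and [ae_section2] for its transpose. *)
Lemma Linfty_integral_op k f M : L2 pi k -> L2 mu f ->
  {ae mu, forall x, {ae mu, forall y, `|k (x, y)| <= M}} ->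
  Linfty mu (integral_op mu k f).
Proof.
move=> k2 f2 kM; apply/(LinftyP mu_gt0); split.
  exact: L2_measurable (L2_integral_op k2 f2).
exists (M * \int[mu]_y `|f y|).
have := L2_section1 k2; apply: filterS2 kM => x kM kx.
have I := L2_mul kx f2.
apply: le_trans (le_normr_Rintegral measurableT I) _.
have If := integrableR_norm (L2_integrable f2).
rewrite -RintegralZl//; apply: ae_le_Rintegral.
- exact: (integrableR_norm I).
- exact: integrableRZ.
- by apply: filterS kM => y kyM; rewrite normrM ler_wpM2r.
Qed.

Lemma Linfty_fixpoint k f : L2 pi k -> L2 mu f -> Linfty pi k ->
  integral_op mu k f = f %[ae mu] -> Linfty mu f.
Proof.
move=> k2 f2 /(LinftyP (product_measure_gt0 mu_gt0))[_ [M kM]] kf.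
apply: (ae_eq_Linfty mu_gt0 (L2_measurable f2) kf).
exact: Linfty_integral_op k2 f2 (ae_section1 kM).
Qed.

(** Solving the equation for g writes it as [c] plus an image under the bounded transposed
    kernel. *)
Lemma Linfty_id_minus_adjoint k g c : L2 pi k -> L2 mu g -> Linfty pi k ->
  Linfty mu c -> id_minus (adjoint mu (integral_op mu k)) g = c %[ae mu] ->
  Linfty mu g.
Proof.
move=> k2 g2 /(LinftyP (product_measure_gt0 mu_gt0))[_ [M kM]] cy gc.
have ty := Linfty_integral_op (L2_kernel_tr k2) g2 (ae_section2 kM).
apply: (ae_eq_Linfty mu_gt0 (L2_measurable g2) _ (LinftyD mu_gt0 cy ty)).
have := adjoint_integral_op k2 g2;
  apply: filterS2 gc => x /(_ I) <- /(_ I) <- _.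
by rewrite /id_minus subrK.
Qed.

End adjoints_and_bounds.

Lemma unique_solution_inner d (T : measurableType d) (R : realType)
    (mu : {measure set T -> \bar R}) (J : (T -> R) -> R) (K : set (T -> R))
    (k : T -> R) (a : R) :
  0 < a -> K k ->
  (forall k', K k' -> [/\ L2 mu k', L2norm mu k' = 1 & J k' = - (a * inner mu
    k' k)]) ->
  unique_solution mu J K k.
Proof.
move=> a0 Kk KP; have [k2 kN Jk] := KP k Kk.
have kk : inner mu k k = 1 by rewrite -sqr_L2norm kN expr1n.
split => // k' Kk'; have [k'2 k'N Jk'] := KP k' Kk'.
  rewrite Jk Jk' lerN2 ler_pM2l// kk.
  have := normr_inner_le k'2 k2; rewrite k'N kN mulr1.
  by apply: le_trans; exact: ler_norm.
move=> /(_ k Kk); rewrite Jk Jk' lerN2 ler_pM2l// kk => h1.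
have d2 := L2B k'2 k2.
(* Between unit vectors |k' - k|^2 = 2 - 2 <k', k>, and optimality of k' forces <k', k> >= 1. *)
have : inner mu (fun p => k' p - k p) (fun p => k' p - k p) = 0.
  apply/eqP; rewrite eq_le inner_ge0 andbT innerBl// !innerBr// (innerC _ k k').
  by rewrite -(sqr_L2norm mu k') k'N kk; lra.
move=> /(inner_eq0 d2); apply: filterS => p /(_ I) /eqP + _.
by rewrite subr_eq0 => /eqP.
Qed.

(** * Response and adjoint resolvent on the unit interval *)

Section unit_interval.
Variable R : realType.
Local Notation mu := (m01 R).
Local Notation pi := (m01x2 R).

Lemma m01_setT : mu setT = 1%E.
Proof.
rewrite /m01/= /mfrestr /mrestr setTI lebesgue_measure_itv/= lte_fin ltr01.
by rewrite oppr0 adde0.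
Qed.

Lemma measurable_level_set (k : R * R -> R) (l : R) :
  measurable_fun [set: measurableTypeR R * measurableTypeR R] k ->
  measurable (level_set k l : set (measurableTypeR R * measurableTypeR R)).
Proof.
move=> mk; rewrite (_ : level_set k l =
  (@itv01 R `*` @itv01 R) `&` (setT `&` k @^-1` `[l, +oo[)); last first.
  apply/seteqP; split=> -[x y] /=.
    by move=> [? ? lk]; rewrite in_itv/= lk.
  by move=> [[? ?] [_]]; rewrite in_itv/= andbT.
apply: measurableI; first by apply: measurableX; exact: measurable_itv.
by apply: mk => //; exact: measurable_itv.
Qed.

Variables (k0 : R * R -> R) (f0 c : R -> R).
Local Notation L0 := (kernel_op k0).
Local Notation h := (adjoint_resolvent L0 f0 c).
Hypothesis k02 : L2 pi k0.
Hypothesis k0_stoch : stochastic k0.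
Hypothesis L0_A1 : A1 L0.
Hypothesis f0_inv : invariant_density L0 f0.
Hypothesis c2 : L2 mu c.
(* Guarantees that [h] is not the junk value 0. *)
Hypothesis h_neq0 : h <> cst 0.

Let f02 : L2 mu f0. Proof. by case: f0_inv. Qed.

(** [xget] returns either a solution or its default [cst 0]; excluding the default leaves a
    solution. *)
Lemma adjoint_resolventP : L2 mu h /\ id_minus (adjoint mu L0) h = c %[ae mu].
Proof.
move: h_neq0; rewrite /adjoint_resolvent /inverse_on.
by case: xgetP => [f -> [[f2 _] fE]|].
Qed.

(** The fibres of [k] have zero mean, so by Fubini [kernel_op k f0] has zero mean too, and
    [id_minus_Markov_surjective] provides a solution. The response is thus never the default value
    on [V_ker]. *)
Lemma responseP k : V_ker k ->
  [/\ L2 mu (response L0 f0 k), \int[mu]_x response L0 f0 k x = 0 &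
   id_minus L0 (response L0 f0 k) = kernel_op k f0 %[ae mu]].
Proof.
move=> [k2 ky0].
suff : exists f, V f /\ id_minus L0 f = kernel_op k f0 %[ae mu].
  by move=> /(@xgetPex _ (cst 0) [set f | V f /\ id_minus L0 f = kernel_op k f0
    %[ae mu]])[[? ?] ?]; split.
have kf2 : L2 mu (kernel_op k f0) by exact: L2_integral_op k2 f02.
have [k0_ge0 k0_int1] := k0_stoch.
have [_ _ f0_int1] := f0_inv.
have L_cvg0 g : L2 mu g -> \int[mu]_x g x = 0 ->
    (fun n => L2norm mu (iter n (integral_op mu k0) g)) @ \oo --> 0.
  by move=> g2 g0; exact: (fine_cvg (L0_A1 (conj g2 g0))).
have kf0 : \int[mu]_x kernel_op k f0 x = 0.
  rewrite (Rintegral_integral_op k2 f02) (@ae_eq_Rintegral _ _ _ mu _ (cst 0)).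
  - by rewrite Rintegral_cst// mul0r.
  - apply: measurable_funM; first exact: L2_measurable f02.
    exact: measurable_Rintegral2 (L2_measurable k2).
  - exact: measurable_cst.
  - by apply: filterS ky0 => y -> _; rewrite mulr0.
have [u [u2 u0 uE]] := id_minus_Markov_surjective m01_setT k02 k0_ge0 k0_int1
  f02 f0_int1 L_cvg0 kf2 kf0.
by exists u.
Qed.

(** With r the response, replace c by h minus the adjoint of L0 applied to h, then move the adjoint:
    <c, r> = <h, r - L0 r> = <h, kernel_op k f0>, which is a double integral of k(x, y) h(x)
    f0(y). *)
Lemma inner_response k : V_ker k ->
  inner mu c (response L0 f0 k) = inner pi k (fun p => h p.1 * f0 p.2).
Proof.
move=> Vk; have [r2 _ rE] := responseP Vk; have [k2 _] := Vk.
have [h2 hE] := adjoint_resolventP.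
have [a2 aE] := adjointP k02 h2.
have Lr2 := L2_integral_op k02 r2.
have kf2 := L2_integral_op k2 f02.
rewrite -(inner_integral_op k2 f02 h2).
rewrite (@ae_eq_inner _ _ _ mu c (id_minus (adjoint mu L0) h) (response L0 f0
  k) (response L0 f0 k))//.
- rewrite innerBl// (innerC _ (adjoint _ _ _)) -(aE _ r2) (innerC _
    (integral_op _ _ _)).
  rewrite -innerBr//; apply: ae_eq_inner => //; first exact: L2B.
  exact: ae_eq_refl.
- exact: L2B h2 a2.
- exact: ae_eq_sym.
- exact: ae_eq_refl.
Qed.

End unit_interval.

Theorem theorem5p4 (R : realType) (l : R) (k0 : R * R -> R) (f0 c : R -> R)
    (Xi' : set R) :
  let L0 := kernel_op k0 in
  let F := level_set k0 l in
  let h := adjoint_resolvent L0 f0 c in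
  0 < l < 1 ->
  L2 (m01x2 R) k0 ->
  stochastic k0 ->
  A1 L0 ->
  invariant_density L0 f0 ->
  orth_compl (m01 R) (span1 f0) c ->
  measurable (Xi' : set (measurableTypeR R)) ->
  Xi' `<=` Xi F ->
  (0 < m01 R Xi')%E ->
  (forall y, Xi' y ->
    [/\ 0 < f0 y,
        0 < \int[m01 R]_(x in ysection F y) h^\+ x &
        0 < \int[m01 R]_(x in ysection F y) h^\- x]) ->
  exists alpha : R,
    [/\ 0 < alpha,
        L2norm (m01x2 R) (optimal_kernel F f0 h alpha) = 1,
        unique_solution (m01x2 R)
          (fun k => - inner (m01 R) c (response L0 f0 k))
          [set k | (@V_ker R `&` supported_in F) k /\
                   L2norm (m01x2 R) k ^+ 2 - 1 = 0]
          (optimal_kernel F f0 h alpha) &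
        Linfty (m01 R) c -> Linfty (m01x2 R) k0 -> L1_compact (m01 R) L0 ->
          Linfty (m01x2 R) (optimal_kernel F f0 h alpha)].
Proof.
move=> L0 F h _ k02 k0_stoch L0_A1 f0_inv [c2 _] mXi _ Xi_gt0 Xi_h.
have mu1 := m01_setT R.
have f02 : L2 (m01 R) f0 by case: f0_inv.
(* A set of positive measure has a point y, and at that y the integral of h^+ would be 0 if h were
   the default. *)
have h_neq0 : h <> cst 0.
  move=> h0; have [y /Xi_h[_ + _]] : exists y, Xi' y.
    apply: contrapT => /forallNP Xi0; move: Xi_gt0.
    by rewrite (_ : Xi' = set0) ?measure0 ?ltxx//; apply/seteqP;
      split => // y /Xi0.
  rewrite h0 Rintegral_mkcond (@eq_Rintegral _ _ _ _ _ (cst 0)).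
    by rewrite Rintegral_cst// mul0r ltxx.
  by move=> x _; rewrite patchE; case: ifP => // _; rewrite /funrpos /cst maxxx.
have [h2 hE] := adjoint_resolventP h_neq0.
have mF := measurable_level_set l (L2_measurable k02).
pose P := centered_tensor (m01 R) F f0 h.
have P2 : L2 (m01x2 R) P by exact: L2_centered_tensor.
(* The norm of P serves twice: as the normalising constant of the optimum and as the factor in front
   of <k, ko> in the objective. *)
pose alpha := L2norm (m01x2 R) P.
have alpha_gt0 : 0 < alpha by exact: (L2norm_centered_tensor_gt0 mF f02 h2 mXi
  Xi_gt0 Xi_h).
have optE : optimal_kernel F f0 h alpha = (fun p => alpha^-1 * P p).
  apply/funext => p; rewrite /optimal_kernel /P /centered_tensor.
  by case: ifP => _; rewrite ?mulr0// mulrA [f0 _ / _]mulrC.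
set ko := optimal_kernel F f0 h alpha in optE *.
have ko2 : L2 (m01x2 R) ko by rewrite optE; exact: L2Z.
have koN : L2norm (m01x2 R) ko = 1.
  by rewrite optE L2normZ// normfV gtr0_norm// mulVf// gt_eqF.
have JE k : V_ker k -> supported_in F k ->
    inner (m01 R) c (response L0 f0 k) = alpha * inner (m01x2 R) k ko.
  move=> Vk [_ kF]; have [k2 ky0] := Vk.
  rewrite (inner_response k02 k0_stoch L0_A1 f0_inv c2 h_neq0 Vk).
  rewrite (inner_centered_tensor mF f02 h2 k2 ky0 kF) -/P optE innerZr//.
  by rewrite mulrA divff ?mul1r// gt_eqF.
have norm1 k : L2norm (m01x2 R) k ^+ 2 - 1 = 0 -> L2norm (m01x2 R) k = 1.
  move=> /eqP; rewrite subr_eq0 sqrp_eq1 ?L2norm_ge0// => /eqP//.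
have koV : V_ker ko.
  split=> //; have := L2_section2 P2; apply: filterS => y Py.
  rewrite optE RintegralZl//; last exact: L2_integrable Py.
  rewrite (_ : \int[m01 R]_x P (x, y) = 0) ?mulr0//.
  exact: Rintegral_centered_tensor.
have koF : supported_in F ko.
  split=> //; apply: aeW => p Fp; rewrite optE /P centered_tensor_out ?mulr0//.
exists alpha; rewrite -/ko; split; [exact: alpha_gt0|exact: koN| |].
- apply: (unique_solution_inner alpha_gt0).
    by split; [split; [exact: koV|exact: koF]|rewrite koN expr1n subrr].
  move=> k [[Vk kF] kN]; split; [by case: Vk|exact: norm1|].
  by congr (- _); exact: JE.
- move=> cy k0y _.
  have mu0 : (0 < m01 R setT)%E by rewrite [ltRHS]mu1.
  have [_ f0E _] := f0_inv.
  have f0y := Linfty_fixpoint mu0 k02 f02 k0y f0E.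
  have hy := Linfty_id_minus_adjoint mu0 k02 h2 k0y cy hE.
  rewrite optE; apply: LinftyZ; first exact: product_measure_gt0.
  exact: Linfty_centered_tensor mF f02 h2 mu0 f0y hy.
Qed.
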